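(* For every $m\ge1$ and every $1\le p<\infty$, $$\mathfrak{G}_p:=\inf\{F_p(\Omega):\Omega \text{ open in }\mathbb{R}^m,\ 0<|\Omega|<\infty\}=0.$$
   Context: For a non-empty open $\Omega\subset\mathbb{R}^m$ with $|\Omega|<\infty$, $\lambda_1(\Omega)=\inf_{\varphi\in H_0^1(\Omega)\setminus\{0\}}\int_\Omega|D\varphi|^2/\int_\Omega\varphi^2$, $v_\Omega$ is the unique solution of $-\Delta v=1$, $v\in H_0^1(\Omega)$, and $F_p(\Omega)=\|v_\Omega\|_{L^p(\Omega)}\lambda_1(\Omega)/|\Omega|^{1/p}$. *)

(* Defs.v *)
(* Euclidean space R^m is 'rV[R]_m (with the
   matrix normed-space topology), R : realType. *)
From HB Require Import structures.
From mathcomp Require Import all_boot all_order all_algebra.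
From mathcomp Require Import all_classical all_reals all_analysis.
Set Implicit Arguments. Unset Strict Implicit. Unset Printing Implicit Defensive.
Import Order.TTheory GRing.Theory Num.Theory.
Import numFieldNormedType.Exports.
Local Open Scope classical_set_scope.
Local Open Scope ring_scope.

Section Defs.
Context {R : realType}.

Definition rV_of_tuple (m : nat) (t : m.-tuple R) : 'rV[R]_m :=
  \row_(i < m) tnth t i.

(* Borel measurability of a function on R^m (product Borel sigma-algebra,
   i.e. the sigma-algebra generated by the coordinate maps, which is the
   Borel sigma-algebra of R^m). *)
Definition borel_fun (m : nat) (f : 'rV[R]_m -> R) : Prop :=
  measurable_fun [set: m.-tuple R] (f \o @rV_of_tuple m).

(* Integral over R^m w.r.t. m-dimensional Lebesgue measure, computed as an
   iterated one-dimensional Lebesgue integral (Tonelli/Fubini: this is the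
   Lebesgue integral for nonnegative Borel and for integrable integrands). *)
Fixpoint integ (m : nat) : ('rV[R]_m -> \bar R) -> \bar R :=
  match m with
  | 0 => fun f => f 0
  | m'.+1 => fun f =>
      (\int[@lebesgue_measure R]_x
         integ (fun t : 'rV[R]_m' => f (row_mx (x%:M : 'rV[R]_1) t)))%E
  end.

Definition leb (m : nat) (A : set 'rV[R]_m) : \bar R :=
  integ (fun x => (\1_A x)%:E).

Definition evec (m : nat) (i : 'I_m) : 'rV[R]_m := delta_mx 0 i.
Definition pd (m : nat) (f : 'rV[R]_m -> R) (i : 'I_m) (x : 'rV[R]_m) : R :=
  'D_(evec i) f x.

Definition grad_sq (m : nat) (f : 'rV[R]_m -> R) (x : 'rV[R]_m) : R :=
  \sum_(i < m) (pd f i x) ^+ 2.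
Definition grad_dot (m : nat) (f g : 'rV[R]_m -> R) (x : 'rV[R]_m) : R :=
  \sum_(i < m) pd f i x * pd g i x.

Definition C1c (m : nat) (Omega : set 'rV[R]_m) (f : 'rV[R]_m -> R) : Prop :=
  (forall i x, derivable f x (evec i)) /\
  (forall i, continuous (pd f i)) /\
  exists K : set 'rV[R]_m, [/\ compact K, K `<=` Omega &
                              forall x, ~ K x -> f x = 0].

(* H_0^1(Omega): u is an element of H_0^1(Omega) represented by the
   sequence phi of C_c^1(Omega) functions, Cauchy in the H^1 norm and
   converging to the (Borel) function u in L^2. *)
Definition H01_approx (m : nat) (Omega : set 'rV[R]_m)
    (phi : nat -> 'rV[R]_m -> R) (u : 'rV[R]_m -> R) : Prop :=
  [/\ forall n, C1c Omega (phi n),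
      (forall e : R, 0 < e -> exists N : nat, forall n k : nat,
         (N <= n)%N -> (N <= k)%N ->
         (integ (fun x => ((phi n x - phi k x) ^+ 2)%:E) +
          integ (fun x => (grad_sq (fun y => phi n y - phi k y) x)%:E)
            < e%:E)%E),
      borel_fun u &
      (fun n => integ (fun x => ((phi n x - u x) ^+ 2)%:E)) @ \oo --> 0%E].

(* Dirichlet energy int |Du|^2 of u in H_0^1 (limit along the approximants). *)
Definition dirichlet (m : nat) (phi : nat -> 'rV[R]_m -> R) : \bar R :=
  lim ((fun n => integ (fun x => (grad_sq (phi n) x)%:E)) @ \oo).

Definition lambda1 (m : nat) (Omega : set 'rV[R]_m) : \bar R :=
  ereal_inf [set q | exists phi u, [/\ H01_approx Omega phi u,
     (0 < integ (fun x => (u x ^+ 2)%:E))%E &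
     q = (dirichlet phi * (integ (fun x => (u x ^+ 2)%:E))^-1)%E]].

(* u is a (weak) solution of -Delta u = 1, u in H_0^1(Omega):
   int Du . Dpsi = int psi for every test function psi. *)
Definition torsion_sol (m : nat) (Omega : set 'rV[R]_m) (u : 'rV[R]_m -> R)
    : Prop :=
  exists phi, H01_approx Omega phi u /\
    forall psi, C1c Omega psi ->
      (fun n => integ (fun x => (grad_dot (phi n) psi x)%:E)) @ \oo -->
        integ (fun x => (psi x)%:E).

(* The torsion function v_Omega (unique up to null sets). *)
Definition torsion (m : nat) (Omega : set 'rV[R]_m) : 'rV[R]_m -> R :=
  xget (fun _ => 0) (torsion_sol Omega).

(* || f ||_{L^p} for 1 <= p < oo (f is zero outside Omega). *)
Definition Lpnorm (m : nat) (p : R) (f : 'rV[R]_m -> R) : R :=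
  (fine (integ (fun x => (`|f x| `^ p)%:E))) `^ p^-1.

Definition Fp (m : nat) (p : R) (Omega : set 'rV[R]_m) : R :=
  Lpnorm p (torsion Omega) * fine (lambda1 Omega)
    / (fine (leb Omega)) `^ p^-1.

End Defs.

(* Main.v *)
Require Import Defs.
From HB Require Import structures.
From mathcomp Require Import all_boot all_order all_algebra.
From mathcomp Require Import all_classical all_reals all_analysis.
From mathcomp Require Import measurable_realfun ring lra.
Set Implicit Arguments.
Unset Strict Implicit.
Unset Printing Implicit Defensive.
Import Order.TTheory GRing.Theory Num.Theory.
Import numFieldNormedType.Exports.
Local Open Scope classical_set_scope.
Local Open Scope ring_scope.

(** Take Omega = U x ]0,1[^(m-1), where U is the interval ]0,1[ followed by M^2
    intervals of length 1/M, so that |Omega| = 1 + M. A bump function in the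
    first unit cube bounds lambda1(Omega) independently of M. On a slab
    a < x_0 < b the torsion function v is at most the one-dimensional solution
    w = (x_0 - a)(b - x_0) / 2 <= (b - a)^2 / 8, hence the integral of |v|^p is
    at most the sum of the cubes of the lengths of the intervals, which is at
    most 2. So F_p(Omega) = O((1 + M)^(-1/p)).

    The weak comparison |v| <= w is obtained by testing the equation with
    psi = G(+-phi_n - w), where phi_n approximates v in H^1_0 and
    G(s) = 1 - 1 / (1 + max(s,0)^2): since 0 <= G' <= 1, both psi and its
    energy are controlled by the Cauchy modulus of phi_n, so that
    G(+-v - w) = 0 almost everywhere. *)

(** * Lebesgue measure on tuples and the iterated integral *)

(** The M^2 intervals of length 1/M add M to the volume but only M^2 / M^3 = 1/M to the sum of
    cubes, so the L^p norm stays bounded while the volume grows; ]0,1[ is kept so that one test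
    function serves every M. The obstacle is that v is given only as an L^2 limit of C^1 functions:
    it has no gradient to work with, and test functions must be C^1 with compact support in Omega.
    This rules out the usual test function, the positive part of v - w. G replaces the positive part
    because it is C^1, vanishes exactly for s <= 0 (so, as w >= 0, the support stays inside that of
    phi_n) and has slope at most 1; max(s,0)^2 alone has unbounded slope. Replacing v by phi_n costs
    an error term that Young's inequality absorbs, and a Poincare inequality in x_0 turns the energy
    bound into an L^2 bound. All integrations by parts are in direction x_0, hence reduce to Fubini
    and the fundamental theorem of calculus on lines. As [integ] is a bare iteration of integrals, a
    genuine measure [leb_tuple] is built first, to have linearity, domination and almost everywhere
    statements. *)

Section lebesgue_tuple.
Context {R : realType}.
Local Open Scope ereal_scope.

Definition cons_pair (m : nat) (z : measurableTypeR R * m.-tuple R) :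
    m.+1.-tuple R :=
  [the m.+1.-tuple R of z.1 :: z.2].

Lemma measurable_cons_pair (m : nat) :
  measurable_fun [set: measurableTypeR R * m.-tuple R] (@cons_pair m).
Proof. exact: measurable_cons. Qed.

Section step.
Variables (m : nat) (mu : {sigma_finite_measure set (m.-tuple R) -> \bar R}).

(** The head coordinate is the first factor, in the order in which [integ] peels off coordinates, so
    that Tonelli reproduces the recursion of [integ]. *)
Definition cons_measure : set (m.+1.-tuple R) -> \bar R :=
  pushforward ((@lebesgue_measure R) \x mu) (@cons_pair m).

Let measurable_preimage A : measurable A -> measurable (@cons_pair m @^-1` A).
Proof.
by move=> mA; rewrite -[X in measurable X]setTI; exact: measurable_cons_pair.
Qed.

Let cons_measure0 : cons_measure set0 = 0.
Proof. by rewrite /cons_measure /pushforward preimage_set0 measure0. Qed.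

Let cons_measure_ge0 A : 0 <= cons_measure A.
Proof. by rewrite /cons_measure /pushforward; exact: measure_ge0. Qed.

Let cons_measure_sigma_additive : semi_sigma_additive cons_measure.
Proof.
move=> F mF tF mUF; rewrite /cons_measure /pushforward preimage_bigcup.
apply: measure_semi_sigma_additive.
- by move=> n; exact: measurable_preimage.
- apply/trivIsetP => /= i j _ _ ij; rewrite -preimage_setI.
  by move/trivIsetP : tF => /(_ _ _ _ _ ij) ->//; rewrite preimage_set0.
- by rewrite -preimage_bigcup; exact: measurable_preimage.
Qed.

HB.instance Definition _ := isMeasure.Build _ _ _ cons_measure
  cons_measure0 cons_measure_ge0 cons_measure_sigma_additive.

(** The product with Lebesgue measure in the next dimension requires sigma-finiteness; the
    exhaustion is pulled back through the inverse of [cons_pair]. *)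
Lemma cons_measure_sigma_finite : sigma_finite setT cons_measure.
Proof.
have /sigma_finiteP[F [TF ndF Foo]] := sigma_finiteT (@lebesgue_measure R).
have /sigma_finiteP[G [TG ndG Goo]] := sigma_finiteT mu.
pose uncons (t : m.+1.-tuple R) := (thead t, [tuple of behead t]).
have mu_uncons : measurable_fun setT uncons.
  apply/measurable_fun_pair; last exact: measurable_behead.
  exact: measurable_tnth.
exists (fun n => uncons @^-1` (F n `*` G n)).
  rewrite predeqE => t; split=> // _.
  have [k _ Fk] : (\bigcup_k F k) (thead t) by rewrite -TF.
  have [l _ Gl] : (\bigcup_k G k) [tuple of behead t] by rewrite -TG.
  exists (maxn k l) => //; split => /=.
  - by apply: (subsetPset _ _ (ndF _ _ (leq_maxl k l))).
  - by apply: (subsetPset _ _ (ndG _ _ (leq_maxr k l))).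
move=> n; have [mF Fn] := Foo n; have [mG Gn] := Goo n; split.
  by rewrite -[X in measurable X]setTI; apply: mu_uncons => //; exact: measurableX.
rewrite /cons_measure /pushforward -comp_preimage.
rewrite (_ : uncons \o _ = id); last first.
  apply/funext => -[x t]; rewrite /uncons /cons_pair /=; congr pair.
  exact/val_inj.
by rewrite preimage_id product_measure1E// lte_mul_pinfty// ge0_fin_numE.
Qed.

HB.instance Definition _ := @Measure_isSigmaFinite.Build _ _ _ cons_measure
  cons_measure_sigma_finite.

End step.

Fixpoint leb_tuple (m : nat) : {sigma_finite_measure set (m.-tuple R) -> \bar R} :=
  match m with
  | 0 => (\d_ ([tuple] : 0.-tuple R) : {sigma_finite_measure set _ -> \bar R})
  | m'.+1 => cons_measure (leb_tuple m')
  end.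

Lemma rV_of_cons (m : nat) (x : R) (t : m.-tuple R) :
  rV_of_tuple (cons_pair (x, t)) =
  row_mx (x%:M : 'rV[R]_1) (rV_of_tuple t) :> 'rV_(m.+1).
Proof.
apply/rowP => i; rewrite !mxE.
case: splitP => j; rewrite ?mxE => ij.
  rewrite ord1 in ij *; rewrite eqxx/= (_ : i = ord0)//; exact/val_inj.
rewrite (_ : i = lift ord0 j) ?tnthS//; exact/val_inj.
Qed.

(** Induction on the dimension: Tonelli splits off the head coordinate, and each section is again
    measurable and nonnegative. *)
Lemma integ_ge0E (m : nat) (f : 'rV[R]_m -> \bar R) :
  measurable_fun [set: m.-tuple R] (f \o @rV_of_tuple R m) -> (forall x, 0 <= f x) ->
  integ f = \int[leb_tuple m]_t f (rV_of_tuple t).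
Proof.
elim: m f => [|m IH] f mf f0 /=.
  rewrite integral_dirac// diracT mul1e; congr f.
  by apply/rowP => -[].
rewrite [RHS](ge0_integral_pushforward (@measurable_cons_pair m))//.
rewrite preimage_setT.
have mg : measurable_fun [set: measurableTypeR R * m.-tuple R]
    ((f \o @rV_of_tuple R m.+1) \o @cons_pair m).
  exact: (measurableT_comp mf (@measurable_cons_pair m)).
rewrite fubini_tonelli1//; last by move=> z; exact: f0.
apply: eq_integral => x _.
rewrite /fubini_F /= IH//.
  by apply: eq_integral => t _; rewrite rV_of_cons.
have -> : (fun t : 'rV[R]_m => f (row_mx (x%:M : 'rV[R]_1) t)) \o
    @rV_of_tuple R m =
    (fun t => ((f \o @rV_of_tuple R m.+1) \o @cons_pair m) (x, t)).
  by apply/funext => t /=; rewrite rV_of_cons.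
exact: (measurableT_comp mg).
Qed.

End lebesgue_tuple.

(** * Open sets and continuous functions are Borel for the coordinate sigma-algebra *)

Section borel.
Context {R : realType}.

(** Openness comes from the matrix norm, measurability from the coordinates. They meet because an
    open set is a countable union of boxes with rational centre and radius 1/(k+1). *)
Lemma measurable_rV_open (m : nat) (O : set 'rV[R]_m) :
  open O -> measurable (@rV_of_tuple R m @^-1` O).
Proof.
move=> oO.
pose box (qk : 'rV[rat]_m * nat) : set (m.-tuple R) :=
  \bigcap_(i in [set: 'I_m])
    ((fun t => tnth t i) @^-1` ball (ratr (qk.1 ord0 i) : R) (qk.2.+1%:R^-1)).
pose good (qk : 'rV[rat]_m * nat) := `[< box qk `<=` @rV_of_tuple R m @^-1` O >].
have mbox qk : measurable (box qk).
  apply: fin_bigcap_measurable => // i _.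
  rewrite -[X in measurable X]setTI; apply: (@measurable_tnth _ R m i) => //.
  by apply: open_measurable; apply: ball_open; rewrite invr_gt0.
(* The boxes are indexed by [nat] through [pickle]; an index that decodes to nothing, or to a box
   not contained in the open set, contributes the empty set. *)
have -> : @rV_of_tuple R m @^-1` O =
    \bigcup_n (if unpickle n is Some qk then if good qk then box qk else set0
               else set0).
  rewrite predeqE => t; split; last first.
    move=> [n _]; case: unpickle => // qk; rewrite /good.
    by case: asboolP => // + h; apply.
  move=> /= Ot; have /nbhs_ballP[e /= e0 xeO] := open_nbhs_nbhs (conj oO Ot).
  have [k ke] : exists k, k.+1%:R^-1 < e / 2.
    have e20 : 0 < e / 2 by rewrite divr_gt0.
    exists (Num.trunc ((e / 2)^-1)).
    by rewrite invf_plt ?posrE// truncnS_gt.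
  have k0 : 0 < k.+1%:R^-1 :> R by rewrite invr_gt0.
  have H i : {q : rat | `|tnth t i - ratr q| < k.+1%:R^-1}.
    apply: cid.
    have /rat_in_itvoo[q] : tnth t i - k.+1%:R^-1 < tnth t i + k.+1%:R^-1.
      by rewrite ltrD2l gtrN.
    rewrite in_itv/= => /andP[q1 q2]; exists q.
    by rewrite distrC ltr_distl; apply/andP.
  pose q : 'rV[rat]_m := \row_i sval (H i).
  exists (pickle (q, k)) => //; rewrite pickleK.
  have bq : box (q, k) t.
    move=> i _ /=; rewrite /ball/= mxE distrC; exact: (svalP (H i)).
  rewrite ifT//; apply/asboolP => s bs /=; apply: xeO; split => // a i.
  rewrite ord1 !mxE /ball/=.
  rewrite (le_lt_trans (ler_distD (ratr (q ord0 i)) _ _))//.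
  rewrite [ltRHS](splitr e) ltrD//; last exact: lt_trans (bs i I) ke.
  by rewrite distrC (lt_trans (bq i I) ke).
apply: bigcupT_measurable => n; case: unpickle => // qk.
by case: ifP.
Qed.

Lemma continuous_borel_fun (m : nat) (f : 'rV[R]_m -> R) :
  continuous f -> borel_fun f.
Proof.
move=> cf.
apply: (measurability _ (RGenOpens.measurableE R)) => // _ [_ [a [b ->] <-]].
rewrite setTI.
apply: (@measurable_rV_open m (f @^-1` `]a, b[%classic)).
apply: open_comp => // x _; exact: cf.
Qed.

End borel.

(** * Continuous functions with compact support *)

Section Cc.
Context {R : realType}.

Definition tuple_set (m : nat) (A : set R) : set (m.-tuple R) :=
  [set t | forall i, A (tnth t i)].

Lemma measurable_tuple_set (m : nat) (A : set R) :
  measurable A -> measurable (@tuple_set m A).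
Proof.
move=> mA; have -> : @tuple_set m A =
    \bigcap_(i in [set: 'I_m]) ((fun t => tnth t i) @^-1` A).
  by rewrite predeqE => t; split => [At i _|At i]; [exact: At|exact: At i I].
apply: fin_bigcap_measurable => // i _.
by rewrite -[X in measurable X]setTI; apply: (@measurable_tnth _ R m i).
Qed.

Lemma leb_tuple_set (m : nat) (A : set R) : measurable A ->
  leb_tuple m (@tuple_set m A) = (lebesgue_measure A ^+ m)%E.
Proof.
move=> mA; elim: m => [|m IH].
  by rewrite /= diracE mem_set// => -[].
rewrite expeS -IH /= /cons_measure /pushforward.
have -> : @cons_pair R m @^-1` (@tuple_set m.+1 A) = A `*` @tuple_set m A.
  rewrite predeqE => -[x t]; split => [At|[/= xA At] i].
    split; first exact: (At ord0).
    by move=> i /=; have := At (lift ord0 i); rewrite tnthS.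
  by case: (unliftP ord0 i) => [j ->|->//]; rewrite tnthS; exact: At.
by rewrite product_measure1E//; exact: measurable_tuple_set.
Qed.

Definition cube (m : nat) (a : R) : set (m.-tuple R) :=
  @tuple_set m `[- a, a]%classic.

Lemma measurable_cube (m : nat) (a : R) : measurable (@cube m a).
Proof. by apply: measurable_tuple_set; exact: measurable_itv. Qed.

Lemma leb_tuple_cube (m : nat) (a : R) : (leb_tuple m (@cube m a) < +oo)%E.
Proof.
rewrite leb_tuple_set; last exact: measurable_itv.
rewrite lebesgue_measure_itv /=.
by case: ifP => _; rewrite -?EFinB -EFin_expe ltry.
Qed.

Definition cube_supported (m : nat) (f : 'rV[R]_m -> R) (a : R) :=
  forall (x : 'rV[R]_m) i, a < `|x ord0 i| -> f x = 0.

(** Domination by [b] times the indicator of a cube, which has finite measure. *)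
Lemma bounded_cube_integrable (m : nat) (f : 'rV[R]_m -> R) (a b : R) :
  borel_fun f -> (forall x, `|f x| <= b) -> cube_supported f a ->
  (leb_tuple m).-integrable [set: m.-tuple R]
    (fun t => (f (rV_of_tuple t))%:E).
Proof.
move=> mf fb fa.
have mc := @measurable_cube m a.
have ii : (leb_tuple m).-integrable [set: m.-tuple R]
    (fun t => (\1_(@cube m a) t)%:E).
  apply/integrableP; split; first exact/measurable_EFinP.
  rewrite (eq_integral (fun t => (\1_(@cube m a) t)%:E)); last first.
    by move=> t _; rewrite gee0_abs// lee_fin.
  by rewrite integral_indic// setIT; exact: leb_tuple_cube.
have := integrableZl measurableT b ii; apply: le_integrable => //.
  exact/measurable_EFinP.
move=> t _; rewrite -EFinM abse_EFin abse_EFin lee_fin normrM.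
have b0 : 0 <= b by rewrite (le_trans _ (fb 0)).
rewrite (ger0_norm b0) indicE.
case: (boolP (t \in _)) => [_|]; first by rewrite normr1 mulr1.
move=> /negP; rewrite inE => /existsNP[i].
rewrite /= in_itv/= -ler_norml => /negP; rewrite -ltNge => ai.
by rewrite (fa _ i) ?normr0 ?mulr0// mxE.
Qed.

Lemma bounded_cube_integrable_pair (m : nat) (f : 'rV[R]_m.+1 -> R) (a b : R) :
  borel_fun f -> (forall x, `|f x| <= b) -> cube_supported f a ->
  (lebesgue_measure \x (leb_tuple m))%E.-integrable
    [set: measurableTypeR R * m.-tuple R]
    ((fun t => (f (rV_of_tuple t))%:E) \o @cons_pair R m).
Proof.
move=> mf fb fa.
have mef : measurable_fun [set: m.+1.-tuple R]
    (fun t => (f (rV_of_tuple t))%:E) by exact/measurable_EFinP.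
have mg : measurable_fun [set: measurableTypeR R * m.-tuple R]
    ((fun t => (f (rV_of_tuple t))%:E) \o @cons_pair R m).
  exact: (measurableT_comp mef (@measurable_cons_pair R m)).
have /integrableP[_] := bounded_cube_integrable mf fb fa.
rewrite [X in (X < _)%E -> _](ge0_integral_pushforward
  (@measurable_cons_pair R m))//.
  by rewrite preimage_setT => ?; apply/integrableP.
exact: measurableT_comp.
Qed.

Lemma integral_leb_tupleS (m : nat) (f : 'rV[R]_m.+1 -> R) (a b : R) :
  borel_fun f -> (forall x, `|f x| <= b) -> cube_supported f a ->
  (\int[leb_tuple m.+1]_t (f (rV_of_tuple t))%:E =
   \int[lebesgue_measure]_x \int[leb_tuple m]_t
      (f (row_mx (x%:M : 'rV[R]_1) (rV_of_tuple t)))%:E)%E.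
Proof.
move=> mf fb fa; have ig := bounded_cube_integrable_pair mf fb fa.
rewrite [LHS](integral_pushforward (@measurable_cons_pair R m))//; last first.
  exact/measurable_EFinP.
rewrite preimage_setT -integral12_prod_meas1//.
by apply: eq_integral => x _; apply: eq_integral => t _ /=; rewrite rV_of_cons.
Qed.

Lemma integral_leb_tupleS_swap (m : nat) (f : 'rV[R]_m.+1 -> R) (a b : R) :
  borel_fun f -> (forall x, `|f x| <= b) -> cube_supported f a ->
  (\int[leb_tuple m.+1]_t (f (rV_of_tuple t))%:E =
   \int[leb_tuple m]_t \int[lebesgue_measure]_x
      (f (row_mx (x%:M : 'rV[R]_1) (rV_of_tuple t)))%:E)%E.
Proof.
move=> mf fb fa; have ig := bounded_cube_integrable_pair mf fb fa.
rewrite [LHS](integral_pushforward (@measurable_cons_pair R m))//; last first.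
  exact/measurable_EFinP.
rewrite preimage_setT -integral21_prod_meas1//.
by apply: eq_integral => t _; apply: eq_integral => x _ /=; rewrite rV_of_cons.
Qed.

(** Signed counterpart of [integ_ge0E], by Fubini. Boundedness and support in a cube are inherited
    by every slice with the same constants, which lets the induction go through; integrability alone
    passes only to almost every slice. *)
Lemma integ_bounded_cube (m : nat) (f : 'rV[R]_m -> R) (a b : R) :
  borel_fun f -> (forall x, `|f x| <= b) -> cube_supported f a ->
  integ (fun x => (f x)%:E) =
  (\int[leb_tuple m]_t (f (rV_of_tuple t))%:E)%E.
Proof.
elim: m f => [|m IH] f mf fb fa.
  rewrite /= integral_dirac//; last exact/measurable_EFinP.
  by rewrite diracT mul1e; congr (f _)%:E; apply/rowP => -[].
rewrite (integral_leb_tupleS mf fb fa) /=.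
apply: eq_integral => x _.
rewrite (IH (fun t => f (row_mx (x%:M : 'rV[R]_1) t)))//.
- rewrite /borel_fun.
  have -> : (fun t => f (row_mx (x%:M : 'rV[R]_1) t)) \o @rV_of_tuple R m =
      (fun t => (f \o @rV_of_tuple R m.+1) (cons_pair (x, t))).
    by apply/funext => t; rewrite /= rV_of_cons.
  apply: (measurableT_comp mf).
  exact: (measurableT_comp (@measurable_cons_pair R m)).
- move=> t i ai; apply: (fa _ (rshift 1 i)).
  by move: ai; rewrite -(row_mxEr (x%:M : 'rV[R]_1) t).
Qed.

Definition Cc (m : nat) (f : 'rV[R]_m -> R) : Prop :=
  continuous f /\ exists a, cube_supported f a.

Lemma Cc_bounded (m : nat) (f : 'rV[R]_m -> R) :
  Cc f -> exists b, forall x, `|f x| <= b.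
Proof.
move=> [cf [a fa]].
pose K := [set x : 'rV[R]_m | forall i, `[- a, a]%classic (x ord0 i)].
have cK : compact K.
  by apply: (@rV_compact _ m (fun=> `[- a, a]%classic)) => i; exact: segment_compact.
have /compact_bounded[M [_ Mb]] : compact (f @` K).
  by apply: continuous_compact => //; exact: continuous_subspaceT.
exists (`|M| + 1) => x.
have M0 : 0 <= `|M| + 1 by rewrite addr_ge0.
have [Kx|nKx] := pselect (K x).
  apply: (Mb (`|M| + 1)); last by exists x.
  by rewrite (le_lt_trans (ler_norm M))// ltrDl.
move/existsNP : nKx => [i /=].
rewrite in_itv/= -ler_norml => /negP; rewrite -ltNge => ai.
by rewrite (fa _ _ ai) normr0.
Qed.

Lemma Cc_integrable (m : nat) (f : 'rV[R]_m -> R) : Cc f ->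
  (leb_tuple m).-integrable [set: m.-tuple R]
    (fun t => (f (rV_of_tuple t))%:E).
Proof.
move=> Cf; have [b fb] := Cc_bounded Cf; case: Cf => cf [a fa].
exact: bounded_cube_integrable (continuous_borel_fun cf) fb fa.
Qed.

Definition Rint (m : nat) (f : 'rV[R]_m -> R) : R :=
  (\int[leb_tuple m]_t f (rV_of_tuple t)).

Lemma integ_Cc (m : nat) (f : 'rV[R]_m -> R) : Cc f ->
  integ (fun x => (f x)%:E) = (Rint f)%:E.
Proof.
move=> Cf; have [b fb] := Cc_bounded Cf; have fi := Cc_integrable Cf.
case: Cf => cf [a fa].
rewrite (integ_bounded_cube (continuous_borel_fun cf) fb fa).
by rewrite /Rint /Rintegral fineK//; exact: integrable_fin_num.
Qed.

Lemma RintD (m : nat) (f g : 'rV[R]_m -> R) : Cc f -> Cc g ->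
  Rint (fun x => f x + g x) = Rint f + Rint g.
Proof. by move=> Cf Cg; apply: RintegralD => //; exact: Cc_integrable. Qed.

Lemma RintB (m : nat) (f g : 'rV[R]_m -> R) : Cc f -> Cc g ->
  Rint (fun x => f x - g x) = Rint f - Rint g.
Proof. by move=> Cf Cg; apply: RintegralB => //; exact: Cc_integrable. Qed.

Lemma RintZ (m : nat) (k : R) (f : 'rV[R]_m -> R) : Cc f ->
  Rint (fun x => k * f x) = k * Rint f.
Proof. by move=> Cf; apply: RintegralZl => //; exact: Cc_integrable. Qed.

Lemma le_Rint (m : nat) (f g : 'rV[R]_m -> R) : Cc f -> Cc g ->
  (forall x, f x <= g x) -> Rint f <= Rint g.
Proof. by move=> Cf Cg fg; apply: le_Rintegral => //; exact: Cc_integrable. Qed.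

Lemma Rint_ge0 (m : nat) (f : 'rV[R]_m -> R) :
  (forall x, 0 <= f x) -> 0 <= Rint f.
Proof. by move=> f0; apply: Rintegral_ge0. Qed.

Lemma CcD (m : nat) (f g : 'rV[R]_m -> R) : Cc f -> Cc g ->
  Cc (fun x => f x + g x).
Proof.
move=> [cf [a fa]] [cg [b gb]]; split.
  by move=> x; exact: (cvgD (cf x) (cg x)).
exists (Num.max a b) => x i; rewrite gt_max => /andP[ax bx].
by rewrite (fa _ _ ax) (gb _ _ bx) addr0.
Qed.

Lemma CcMl (m : nat) (f g : 'rV[R]_m -> R) : continuous f -> Cc g ->
  Cc (fun x => f x * g x).
Proof.
move=> cf [cg [b gb]]; split.
  by move=> x; exact: (cvgM (cf x) (cg x)).
by exists b => x i bx; rewrite (gb _ _ bx) mulr0.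
Qed.

Lemma CcM (m : nat) (f g : 'rV[R]_m -> R) : Cc f -> Cc g ->
  Cc (fun x => f x * g x).
Proof. by move=> [cf _]; exact: CcMl. Qed.

Lemma CcZ (m : nat) (k : R) (f : 'rV[R]_m -> R) : Cc f -> Cc (fun x => k * f x).
Proof. by apply: (@CcMl m (cst k)); exact: cst_continuous. Qed.

Lemma CcB (m : nat) (f g : 'rV[R]_m -> R) : Cc f -> Cc g ->
  Cc (fun x => f x - g x).
Proof.
move=> Cf /(CcZ (-1)) /(CcD Cf).
by under eq_fun do rewrite mulN1r.
Qed.

Lemma CcX2 (m : nat) (f : 'rV[R]_m -> R) : Cc f -> Cc (fun x => f x ^+ 2).
Proof. by move=> Cf; under eq_fun do rewrite expr2; exact: CcM. Qed.

Lemma Cc_sum (m n : nat) (f : 'I_n -> 'rV[R]_m -> R) :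
  (forall i, Cc (f i)) -> Cc (fun x => \sum_(i < n) f i x).
Proof.
elim: n f => [|n IH] f Cf.
  under eq_fun do rewrite big_ord0; split; last by exists 0.
  exact: cst_continuous.
under eq_fun do rewrite big_ord_recl.
by apply: CcD => //; apply: IH.
Qed.

End Cc.

(** * Calculus in C1c *)

Section directional.
Context {R : realType}.

(** Brings directional derivatives back to one variable, where the chain rule, the mean value
    theorem and the fundamental theorem of calculus apply. *)
Lemma is_derive_line (V : normedModType R) (f : V -> R) (x v : V) (s d : R) :
  is_derive (s *: v + x) v f d <->
  is_derive s 1 (fun h : R => f (h *: v + x)) d.
Proof.
have E : (fun h : R => h^-1 *: ((f \o shift (s *: v + x)) (h *: v)
            - f (s *: v + x))) =
    (fun h : R => h^-1 *: (((fun h : R => f (h *: v + x)) \o shift s) (h *: 1)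
            - f (s *: v + x))).
  by apply/funext => h /=; rewrite scalerDl addrA [_%:A]mulr1.
by split => -[d1 d2]; split; rewrite ?/derivable ?/derive ?E// -?E.
Qed.

Lemma is_derive_comp_dir (V : normedModType R) (f : V -> R) (g : R -> R)
    (x v : V) (a b : R) :
  is_derive x v f b -> is_derive (f x) 1 g a ->
  is_derive x v (fun y => g (f y)) (a * b).
Proof.
move=> df dg.
have H (h : V -> R) c :
    is_derive x v h c <-> is_derive (0 : R) 1 (fun s => h (s *: v + x)) c.
  by rewrite -is_derive_line scale0r add0r.
apply/H; apply: is_derive1_comp; last exact/H.
by rewrite scale0r add0r.
Qed.

Lemma is_derive_affine (V : normedModType R) (f : V -> R) (x v : V) (d : R) :
  (forall h : R, f (h *: v + x) = h * d + f x) -> is_derive x v f d.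
Proof.
move=> fE.
have H : (fun h : R => h^-1 *: ((f \o shift x) (h *: v) - f x)) @ 0^' --> d.
  apply: cvg_near_cst; near=> h; rewrite /= fE addrK.
  rewrite [_ *: _]mulrA mulVf ?mul1r//.
  by near: h; exact: nbhs_dnbhs_neq.
by apply: DeriveDef; [apply/cvg_ex; exists d|exact: cvg_lim].
Unshelve. all: by end_near. Qed.

Lemma is_derive_coord (m : nat) (i j : 'I_m) (x : 'rV[R]_m) :
  is_derive x (evec i) (fun y : 'rV[R]_m => y ord0 j) (i == j)%:R.
Proof.
by apply: is_derive_affine => h; rewrite !mxE eqxx/= eq_sym.
Qed.

End directional.

Section C1c.
Context {R : realType}.
Implicit Types (m : nat).

Lemma compact_rV_closed m (K : set 'rV[R]_m) : compact K -> closed K.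
Proof. by apply: compact_closed; exact: norm_hausdorff. Qed.

Lemma compact_rV_cube m (K : set 'rV[R]_m) : compact K ->
  exists a : R, forall (x : 'rV[R]_m) i, a < `|x ord0 i| -> ~ K x.
Proof.
move=> /compact_bounded[M [_ Mb]]; exists (`|M| + 1) => x i xi Kx.
have : `|x| <= `|M| + 1.
  by apply: Mb => //; rewrite (le_lt_trans (ler_norm M))// ltrDl.
apply/negP; rewrite -ltNge (lt_le_trans xi)//.
by rewrite /Num.norm/= mx_normrE (le_bigmax _ _ (ord0, i)).
Qed.

Lemma is_derive_near0 m (f : 'rV[R]_m -> R) (K : set 'rV[R]_m) x v :
  closed K -> (forall x, ~ K x -> f x = 0) -> ~ K x -> is_derive x v f 0.
Proof.
move=> cK f0 nKx; apply: (@near_eq_is_derive _ _ _ (cst 0)).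
have : open_nbhs x (~` K) by split => //; exact: closed_openC.
move=> /open_nbhs_nbhs; apply: filterS => y Ky; by rewrite f0.
Qed.

Lemma is_derive_pd m (f : 'rV[R]_m -> R) i x d :
  is_derive x (evec i) f d -> pd f i x = d.
Proof. by move=> [_]. Qed.

(* A function that vanishes off a compact subset of Omega only has to be
   differentiated inside Omega. *)
Lemma C1c_local m (Omega K : set 'rV[R]_m) (f : 'rV[R]_m -> R)
    (df : 'I_m -> 'rV[R]_m -> R) :
  compact K -> K `<=` Omega -> (forall x, ~ K x -> f x = 0) ->
  (forall i x, ~ K x -> df i x = 0) ->
  (forall i x, Omega x -> is_derive x (evec i) f (df i x)) ->
  (forall i x, Omega x -> {for x, continuous (df i)}) ->
  C1c Omega f /\ forall i x, pd f i x = df i x.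
Proof.
move=> cK KO f0 df0 fdf cdf; have clK := compact_rV_closed cK.
have fdfT i x : is_derive x (evec i) f (df i x).
  have [Kx|nKx] := pselect (K x); first exact/fdf/KO.
  by rewrite df0//; exact: is_derive_near0 clK f0 nKx.
have pdE i : pd f i = df i by apply/funext => x; exact: is_derive_pd.
split; last by move=> i x; rewrite pdE.
split; [|split]; last by exists K.
  by move=> i x; have [] := fdfT i x.
move=> i x; rewrite pdE; have [Kx|nKx] := pselect (K x).
  exact/cdf/KO.
apply: (near_cst_continuous 0).
have : open_nbhs x (~` K) by split => //; exact: closed_openC.
by move=> /open_nbhs_nbhs; apply: filterS => y Ky; rewrite df0.
Qed.

Lemma C1c_pd0 m (Omega : set 'rV[R]_m) f : C1c Omega f ->
  exists K : set 'rV[R]_m, [/\ compact K, K `<=` Omega,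
   forall x, ~ K x -> f x = 0 & forall i x, ~ K x -> pd f i x = 0].
Proof.
move=> [_ [_ [K [cK KO f0]]]]; exists K; split=> // i x nKx.
exact/is_derive_pd/(is_derive_near0 _ (compact_rV_closed cK) f0).
Qed.

Lemma C1c_Cc_pd m (Omega : set 'rV[R]_m) f i : C1c Omega f -> Cc (pd f i).
Proof.
move=> Cf; have [K [cK _ _ df0]] := C1c_pd0 Cf.
case: Cf => _ [cdf _]; split => //.
have [a Ka] := compact_rV_cube cK; exists a => x j aj.
exact: df0 (Ka _ _ aj).
Qed.

End C1c.

Section C1c_continuous.
Context {R : realType}.
Implicit Types (m : nat).

Lemma C1c_is_derive m (Omega : set 'rV[R]_m) f i x :
  C1c Omega f -> is_derive x (evec i) f (pd f i x).
Proof. by move=> [df _]; exact: derivableP. Qed.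

Lemma C1c_pd_bounded m (Omega : set 'rV[R]_m) f : C1c Omega f ->
  exists2 b : R, 0 <= b & forall i x, `|pd f i x| <= b.
Proof.
move=> Cf.
have /choice[b fb] : forall i, exists b, forall x, `|pd f i x| <= b.
  by move=> i; exact/Cc_bounded/(C1c_Cc_pd i Cf).
have b0 i : 0 <= b i by exact: le_trans (fb i 0).
exists (\sum_i b i); first exact: sumr_ge0.
move=> i x; apply: (le_trans (fb i x)).
by rewrite (bigD1 i)//= lerDl sumr_ge0.
Qed.

Lemma MVT_line m (f : 'rV[R]_m -> R) (v x : 'rV[R]_m) (df : 'rV[R]_m -> R)
    (b h : R) :
  (forall y, is_derive y v f (df y)) -> (forall y, `|df y| <= b) ->
  `|f (h *: v + x) - f x| <= b * `|h|.
Proof.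
move=> fdf dfb; pose g (s : R) := f (s *: v + x).
have gdg (s : R) : is_derive s 1 g (df (s *: v + x)).
  exact: (is_derive_line f x v s _).1 (fdf _).
have cg (a c : R) : {within `[a, c], continuous g}.
  by apply: derivable_within_continuous => s _; have [] := gdg s.
have gh : f (h *: v + x) - f x = g h - g 0 by rewrite /g scale0r add0r.
rewrite gh; have [h0|h0] := leP 0 h.
- have [s _ ->] := MVT_segment h0 (fun s _ => gdg s) (cg 0 h).
  by rewrite subr0 normrM ler_wpM2r.
- have [s _ E] := MVT_segment (ltW h0) (fun s _ => gdg s) (cg h 0).
  by rewrite distrC E sub0r normrM normrN ler_wpM2r.
Qed.

(** [C1c] speaks of partial derivatives only, so continuity of the function itself has to be
    derived. Going from [x] to [y] one coordinate at a time, each of the [m] moves costs at most [b]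
    times the max norm of [y - x], by the mean value theorem. *)
Lemma C1c_lipschitz m (Omega : set 'rV[R]_m) f : C1c Omega f ->
  exists2 b : R, 0 <= b & forall x y, `|f y - f x| <= b * `|y - x|.
Proof.
move=> Cf; have [b b0 fb] := C1c_pd_bounded Cf.
exists (m%:R * b); first by rewrite mulr_ge0.
move=> x y.
pose z k : 'rV[R]_m := \row_j (if (j < k)%N then y ord0 j else x ord0 j).
have H k : (k <= m)%N -> `|f (z k) - f x| <= k%:R * b * `|y - x|.
  elim: k => [_|k IH km].
    have -> : z 0%N = x by apply/rowP => j; rewrite mxE.
    by rewrite subrr normr0 !mul0r.
  have -> : z k.+1 = (y - x) ord0 (Ordinal km) *: evec (Ordinal km) + z k.
    apply/rowP => j; rewrite !mxE eqxx/=.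
    have [->|jk] := eqVneq j (Ordinal km).
      by rewrite /= ltnn leqnn mulr1 subrK.
    rewrite mulr0 add0r ltnS leq_eqVlt.
    by rewrite (_ : (j == k :> nat) = false)//; apply/negbTE.
  rewrite (le_trans (ler_distD (f (z k)) _ _))//.
  rewrite -natr1 2!mulrDl mul1r [leRHS]addrC lerD ?IH ?(ltnW km)//.
  apply: (le_trans (MVT_line _ _ (fun u => C1c_is_derive (Ordinal km) u Cf)
    (fb _))).
  rewrite ler_wpM2l// /Num.norm/= mx_normrE.
  by rewrite (le_bigmax _ (fun ij => `|(y - x) ij.1 ij.2|) (ord0, Ordinal km)).
have <- : z m = y by apply/rowP => j; rewrite mxE ltn_ord.
by rewrite {2}(_ : z m = y); [exact: H|apply/rowP => j; rewrite mxE ltn_ord].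
Qed.

Lemma C1c_Cc m (Omega : set 'rV[R]_m) f : C1c Omega f -> Cc f.
Proof.
move=> Cf; split.
  have [b b0 fb] := C1c_lipschitz Cf.
  move=> x; apply/(@cvgrPdist_le _ _ _ (nbhs x) _ f (f x)) => e e0.
  have d0 : 0 < e / (b + 1) by rewrite divr_gt0// ltr_wpDl.
  apply: (@nbhs_normP R 'rV[R]_m x _).2; exists (e / (b + 1)) => // y /= /ltW.
  rewrite ler_pdivlMr ?ltr_wpDl// mulrC => xy; rewrite (le_trans (fb _ _))//.
  by apply: le_trans xy; rewrite mulrDl mul1r lerDl.
have [K [cK _ f0 _]] := C1c_pd0 Cf.
have [a Ka] := compact_rV_cube cK; exists a => x j aj.
exact: f0 (Ka _ _ aj).
Qed.

Lemma Cc_grad_dot m (Omega : set 'rV[R]_m) phi psi :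
  C1c Omega phi -> C1c Omega psi -> Cc (grad_dot phi psi).
Proof.
move=> Cphi Cpsi; apply: (@Cc_sum _ _ _ (fun i x => pd phi i x * pd psi i x)) => i.
by apply: CcM; [exact: C1c_Cc_pd Cphi|exact: C1c_Cc_pd Cpsi].
Qed.

Lemma Cc_grad_sq m (Omega : set 'rV[R]_m) phi : C1c Omega phi -> Cc (grad_sq phi).
Proof.
move=> Cphi; apply: (@Cc_sum _ _ _ (fun i x => pd phi i x ^+ 2)) => i.
by apply: CcX2; exact: C1c_Cc_pd Cphi.
Qed.

Lemma C1cB m (Omega : set 'rV[R]_m) phi psi :
  C1c Omega phi -> C1c Omega psi ->
  C1c Omega (fun y => phi y - psi y) /\
  forall i x, pd (fun y => phi y - psi y) i x = pd phi i x - pd psi i x.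
Proof.
move=> Cphi Cpsi; have [K [cK KO phi0 dphi0]] := C1c_pd0 Cphi.
have [K' [cK' KO' psi0 dpsi0]] := C1c_pd0 Cpsi.
apply: (@C1c_local _ _ _ (K `|` K')).
- exact: compactU.
- by move=> x [/KO|/KO'].
- by move=> x /not_orP[? ?]; rewrite phi0// psi0// subr0.
- by move=> i x /not_orP[? ?]; rewrite dphi0// dpsi0// subr0.
- move=> i x _.
  exact: (is_deriveB (C1c_is_derive i x Cphi) (C1c_is_derive i x Cpsi)).
- move=> i x _; have [[_ [cphi _]] [_ [cpsi _]]] := (Cphi, Cpsi).
  exact: (cvgB (cphi i x) (cpsi i x)).
Qed.

End C1c_continuous.

(** * Integration by parts in the first coordinate *)

Section integral_pd.
Context {R : realType}.

Lemma row_mx_line m (x : R) (s : 'rV[R]_m) :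
  row_mx (x%:M : 'rV[R]_1) s =
  x *: evec ord0 + row_mx (0 : 'rV[R]_1) s :> 'rV[R]_m.+1.
Proof.
apply/rowP => i; rewrite !mxE eqxx /=.
case: splitP => j ij; rewrite ?mxE.
  rewrite ord1 in ij *; rewrite (_ : i = ord0) ?eqxx ?mulr1 ?addr0//.
  exact/val_inj.
rewrite (_ : (i == ord0) = false) ?mulr0 ?add0r//.
by apply/negbTE/eqP => i0; rewrite i0 in ij.
Qed.

Lemma integral_derive0 (g dg : R -> R) (a : R) :
  (forall x : R, is_derive x 1 g (dg x)) -> continuous dg ->
  (forall x, a < `|x| -> g x = 0) -> (forall x, a < `|x| -> dg x = 0) ->
  (\int[lebesgue_measure]_x (dg x)%:E = 0)%E.
Proof.
(* The endpoints -c and c lie strictly beyond [a], where [g] vanishes, and the segment is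
   nondegenerate even when [a] is not positive. *)
move=> gdg cdg ga dga; pose c := `|a| + 1.
have c0 : 0 < c by rewrite ltr_wpDl.
have ac : a < c by rewrite (le_lt_trans (ler_norm _))// ltrDl.
pose D : set R := `[- c, c]%classic.
transitivity (\int[lebesgue_measure]_(x in D) (dg x)%:E)%E.
  rewrite [RHS]integral_mkcond; apply: eq_integral => x _.
  rewrite patchE; case: ifPn => // /negP; rewrite inE /D /= in_itv/= -ler_norml.
  by move/negP; rewrite -ltNge => cx; rewrite dga// (lt_trans ac cx).
have cg : continuous g.
  move=> x; apply/differentiable_continuous/derivable1_diffP.
  by have [] := gdg x.
rewrite (@continuous_FTC2 _ dg g).
- by rewrite !ga ?subee// ?normrN gtr0_norm.
- by rewrite gtrN.
- exact: continuous_subspaceT.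
- split => [x _||].
  + by have [] := gdg x.
  + by apply: cvg_at_right_filter; exact: cg.
  + by apply: cvg_at_left_filter; exact: cg.
- by move=> x _; rewrite derive1E; have [] := gdg x.
Qed.

(** Divergence theorem in direction x_0: with x_0 as the innermost variable, the integral over each
    line is that of a derivative with compact support. Both integrations by parts below apply it to
    a suitable product. *)
Lemma Rint_pd0 m (Omega : set 'rV[R]_m.+1) h : C1c Omega h ->
  Rint (pd h ord0) = 0.
Proof.
move=> Ch; have Cpd := C1c_Cc_pd ord0 Ch.
have [K [cK _ h0 dh0]] := C1c_pd0 Ch.
have [a Ka] := compact_rV_cube cK.
have [b pdb] := Cc_bounded Cpd.
case: Cpd => cpd [a' pda].
rewrite /Rint /Rintegral.
rewrite (integral_leb_tupleS_swap (continuous_borel_fun cpd) pdb pda).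
rewrite (eq_integral (cst 0%E)) ?integral0// => t _ /=.
have out (x : R) : a < `|x| ->
    ~ K (x *: evec ord0 + row_mx (0 : 'rV[R]_1) (rV_of_tuple t)).
  have E : row_mx (x%:M : 'rV[R]_1) (rV_of_tuple t) ord0 (lshift m ord0) = x.
    by rewrite row_mxEl mxE eqxx.
  rewrite -row_mx_line => ax; apply: (Ka _ (lshift m (ord0 : 'I_1))).
  by move: ax; rewrite -{1}E.
pose y : 'rV[R]_m.+1 := row_mx (0 : 'rV[R]_1) (rV_of_tuple t).
rewrite (eq_integral (fun x : measurableTypeR R =>
    (pd h ord0 (x *: evec ord0 + y))%:E)); last first.
  by move=> x _; rewrite row_mx_line.
apply: (@integral_derive0 (fun x => h (x *: evec ord0 + y))
  (fun x => pd h ord0 (x *: evec ord0 + y)) a).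
- by move=> x; exact: (is_derive_line h _ _ x _).1 (C1c_is_derive _ _ Ch).
- move=> x; apply: continuous_comp; last exact: cpd.
  apply: cvgD; last exact: cvg_cst.
  by apply: cvgZr_tmp; exact: cvg_id.
- by move=> x /out; exact: h0.
- by move=> x /out; exact: dh0.
Qed.

End integral_pd.

(** * A smooth substitute for the positive part *)

Section truncation.
Context {R : realType}.
Implicit Types s t : R.

Definition pos_sq s : R := Num.max s 0 ^+ 2.

Lemma continuous_max0 : continuous (fun s : R => Num.max s 0).
Proof.
move=> s; apply: (@continuous_max _ _ (@id R) (cst 0)).
- exact: cvg_id.
- exact: cvg_cst.
Qed.

Lemma is_derive_pos_sq s : is_derive s 1 pos_sq (2 * Num.max s 0).
Proof.
have [s0|s0|->] := ltgtP s 0.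
- rewrite mulr0.
  apply: (@near_eq_is_derive _ _ _ (cst 0)).
  near=> t; rewrite /pos_sq max_r ?expr0n//; apply/ltW.
  by near: t; exact: lt_nbhsl.
- apply: (@near_eq_is_derive _ _ _ (fun t => t ^+ 2)).
    near=> t; rewrite /pos_sq max_l//; apply/ltW.
    by near: t; exact: lt_nbhsr.
  apply: DeriveDef; first exact: exprn_derivable.
  by rewrite exp_derive expr1 [_%:A]mulr1.
- rewrite mulr0.
  have H : (fun h : R => h^-1 *: ((pos_sq \o shift 0) (h *: 1) - pos_sq 0))
      @ 0^' --> (0 : R).
    (* At 0 the difference quotient of [pos_sq] is exactly max(h,0). *)
    rewrite (_ : (fun h : R => _) = (fun h : R => Num.max h 0)).
      apply: cvg_trans; first exact: cvg_app (@nbhs_dnbhs _ (0 : R)).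
      have := @continuous_max0 0; rewrite /continuous_at maxxx; exact.
    apply/funext => h; rewrite /= addr0 /pos_sq maxxx expr0n subr0 [_%:A]mulr1.
    have [h0|h0] := leP h 0; first by rewrite expr0n scaler0.
    by rewrite [_ *: _]mulrA mulVf ?mul1r// gt_eqF.
  by apply: DeriveDef; [apply/cvg_ex; exists 0|exact: cvg_lim].
Unshelve. all: by end_near. Qed.

Definition soft_pos s : R := 1 - (1 + pos_sq s)^-1.
Definition dsoft_pos s : R := (2 * Num.max s 0) * (1 + pos_sq s) ^- 2.

Let pos_sq_ge0 s : 0 <= pos_sq s. Proof. exact: sqr_ge0. Qed.
Let pos_sq1_gt0 s : 0 < 1 + pos_sq s. Proof. by rewrite ltr_pwDl. Qed.

Lemma is_derive_soft_pos s : is_derive s 1 soft_pos (dsoft_pos s).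
Proof.
have H : is_derive s 1 (cst 1 + pos_sq) (0 + 2 * Num.max s 0).
  by apply: is_deriveD; exact: is_derive_pos_sq.
have /(_ (lt0r_neq0 (pos_sq1_gt0 s))) HV := is_deriveV _ H.
have := is_deriveB (is_derive_cst (1 : R) s 1) HV.
move/is_derive_eq; apply.
by rewrite sub0r add0r scaleNr opprK /dsoft_pos [_ *: _]mulrC.
Qed.

Lemma continuous_dsoft_pos : continuous dsoft_pos.
Proof.
move=> s; apply: cvgM.
  by apply: cvgM; [exact: cvg_cst|exact: continuous_max0].
have cp : {for s, continuous pos_sq}.
  apply/differentiable_continuous/derivable1_diffP.
  by have [] := is_derive_pos_sq s.
apply: cvgV; first by rewrite expf_neq0// lt0r_neq0.
rewrite expr2; under eq_fun do rewrite expr2.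
by apply: cvgM; apply: cvgD; [exact: cvg_cst|exact: cp|exact: cvg_cst|exact: cp].
Qed.

Lemma dsoft_pos_ge0 s : 0 <= dsoft_pos s.
Proof.
by rewrite mulr_ge0 ?invr_ge0 ?exprn_ge0 ?mulr_ge0 ?le_max ?lexx ?orbT// ltW.
Qed.

(** With t = max(s,0), the claim is (1 + t^2)^2 - 2 t = (t - 1)^2 + t^2 + t^4 >= 0. *)
Lemma dsoft_pos_le1 s : dsoft_pos s <= 1.
Proof.
rewrite /dsoft_pos ler_pdivrMr ?exprn_gt0// mul1r /pos_sq.
have : 0 <= Num.max s 0 by rewrite le_max lexx orbT.
move: (Num.max s 0) => t t0; have := sqr_ge0 (t ^+ 2).
have := sqr_ge0 (t - 1); nra.
Qed.

Lemma soft_pos_le0 s : s <= 0 -> soft_pos s = 0.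
Proof. by move=> s0; rewrite /soft_pos /pos_sq max_r// expr0n addr0 invr1 subrr. Qed.

Lemma dsoft_pos_le0 s : s <= 0 -> dsoft_pos s = 0.
Proof. by move=> s0; rewrite /dsoft_pos max_r// mulr0 mul0r. Qed.

Lemma soft_pos_ge0 s : 0 <= soft_pos s.
Proof. by rewrite subr_ge0 invf_le1// lerDl. Qed.

(** This converse lets the almost everywhere vanishing of the excess be read as the pointwise
    comparison with the barrier. *)
Lemma soft_pos_eq0 s : soft_pos s = 0 -> s <= 0.
Proof.
move/eqP; rewrite subr_eq0 => /eqP /(congr1 GRing.inv); rewrite invr1 invrK.
move=> /esym/eqP; rewrite addrC -subr_eq0 addrK sqrf_eq0 => /eqP ms.
by rewrite -ms le_max lexx.
Qed.

Lemma soft_pos_lipschitz s t : `|soft_pos s - soft_pos t| <= `|s - t|.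
Proof.
wlog st : s t / s <= t.
  by move=> H; case/orP: (le_total s t) => /H//; rewrite distrC [leRHS]distrC.
have := @MVT_segment _ soft_pos dsoft_pos s t st (fun x _ => is_derive_soft_pos x).
case.
  apply: derivable_within_continuous => x _; by have [] := is_derive_soft_pos x.
move=> c _ E; rewrite distrC E [leRHS]distrC normrM ger0_norm ?dsoft_pos_ge0//.
by rewrite ler_piMl// dsoft_pos_le1.
Qed.

Lemma continuous_soft_pos : continuous soft_pos.
Proof.
move=> s; apply/differentiable_continuous/derivable1_diffP.
by have [] := is_derive_soft_pos s.
Qed.

End truncation.

(** * Comparison with a one-dimensional barrier *)

Section comparison.
Context {R : realType} (m : nat) (Omega : set 'rV[R]_m.+1) (w dw : R -> R)
  (L : R).
Hypothesis w_ge0 : forall s, 0 <= w s.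
Hypothesis is_derive_w : forall x : 'rV[R]_m.+1, Omega x ->
  is_derive (x ord0 ord0) 1 w (dw (x ord0 ord0)).
Hypothesis is_derive_dw : forall x : 'rV[R]_m.+1, Omega x ->
  is_derive (x ord0 ord0) 1 dw (-1).
Hypothesis Omega_bounded : forall x : 'rV[R]_m.+1, Omega x ->
  `|x ord0 ord0| <= L.

Implicit Types (x : 'rV[R]_m.+1) (phi psi : 'rV[R]_m.+1 -> R).

Let continuous_coord0 (g : R -> R) (d : R) x :
  is_derive (x ord0 ord0) 1 g d ->
  {for x, continuous (fun y : 'rV[R]_m.+1 => g (y ord0 ord0))}.
Proof.
move=> [dg _]; apply: continuous_comp; first exact: coord_continuous.
exact/differentiable_continuous/derivable1_diffP.
Qed.

(** [dw] is known to be regular on [Omega] only; the product is nevertheless C^1 on the whole space,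
    because [psi] vanishes off a compact subset of [Omega]. *)
Lemma C1c_dwM psi : C1c Omega psi ->
  C1c Omega (fun x => dw (x ord0 ord0) * psi x) /\
  forall i x, pd (fun x => dw (x ord0 ord0) * psi x) i x =
    dw (x ord0 ord0) * pd psi i x - (i == ord0)%:R * psi x.
Proof.
move=> Cpsi; have [K [cK KO psi0 dpsi0]] := C1c_pd0 Cpsi.
apply: (@C1c_local _ _ _ K) => //.
- by move=> x nKx; rewrite psi0// mulr0.
- by move=> i x nKx; rewrite psi0// dpsi0// !mulr0 subr0.
- move=> i x Ox.
  have H1 := is_derive_comp_dir (is_derive_coord i ord0 x) (is_derive_dw Ox).
  have := is_deriveM H1 (C1c_is_derive i x Cpsi).
  move/is_derive_eq; apply.
  by rewrite mulN1r [_ *: - _]mulrC mulNr.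
- move=> i x Ox; have cdw := continuous_coord0 (is_derive_dw Ox).
  have [_ [cpd _]] := Cpsi; have [cpsi _] := C1c_Cc Cpsi.
  exact: (cvgB (cvgM cdw (cpd i x)) (cvgM (cvg_cst _) (cpsi x))).
Qed.

(** Since [dw] may jump outside [Omega], continuity is read off from dw d_0 psi = d_0 (dw psi) +
    psi. *)
Lemma Cc_dw_pd psi : C1c Omega psi ->
  Cc (fun x => dw (x ord0 ord0) * pd psi ord0 x).
Proof.
move=> Cpsi; have [Ch dh] := C1c_dwM Cpsi.
have := CcD (C1c_Cc_pd ord0 Ch) (C1c_Cc Cpsi).
by under eq_fun do rewrite dh eqxx mul1r subrK.
Qed.

(** The weak form of -w'' = 1, obtained by integrating d_0 (dw psi). *)
Lemma Rint_dw_pd psi : C1c Omega psi ->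
  Rint (fun x => dw (x ord0 ord0) * pd psi ord0 x) = Rint psi.
Proof.
move=> Cpsi; have [Ch dh] := C1c_dwM Cpsi.
have := Rint_pd0 Ch.
have -> : pd (fun x => dw (x ord0 ord0) * psi x) ord0 =
    (fun x => dw (x ord0 ord0) * pd psi ord0 x - psi x).
  by apply/funext => x; rewrite dh eqxx mul1r.
rewrite RintB//; [|exact: Cc_dw_pd|exact: C1c_Cc Cpsi].
by move/eqP; rewrite subr_eq0 => /eqP.
Qed.

(* Integrate the derivative of x_0 psi^2. *)
Lemma poincare_coord0 psi : C1c Omega psi ->
  Rint (fun x => psi x ^+ 2) <= 4 * L ^+ 2 * Rint (fun x => pd psi ord0 x ^+ 2).
Proof.
move=> Cpsi; have [K [cK KO psi0 dpsi0]] := C1c_pd0 Cpsi.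
have [Ccpsi Ccpd] := (C1c_Cc Cpsi, C1c_Cc_pd ord0 Cpsi).
pose h x := x ord0 ord0 * psi x ^+ 2.
pose dh (i : 'I_m.+1) x := (i == ord0)%:R * psi x ^+ 2 +
  x ord0 ord0 * (2 * psi x * pd psi i x).
have [Ch dhE] : C1c Omega h /\ forall i x, pd h i x = dh i x.
  apply: (@C1c_local _ _ _ K) => //.
  - by move=> x nKx; rewrite /h psi0// expr0n mulr0.
  - by move=> i x nKx; rewrite /dh psi0// dpsi0// expr0n !mulr0 addr0.
  - move=> i x Ox.
    have H2 := is_deriveX 2 (C1c_is_derive i x Cpsi).
    have := is_deriveM (is_derive_coord i ord0 x) H2.
    move/is_derive_eq; apply.
    rewrite expr1 /dh [LHS]addrC; congr (_ + _).
    by rewrite [LHS]mulrC.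
  - move=> i x Ox.
    have [_ [cpd _]] := Cpsi; have [cpsi _] := C1c_Cc Cpsi.
    have c2 : {for x, continuous (fun x => psi x ^+ 2)}.
      by have [c _] := CcX2 Ccpsi; exact: c.
    exact: (cvgD (cvgM (cvg_cst _) c2)
      (cvgM (@coord_continuous _ _ _ ord0 ord0 x)
        (cvgM (cvgM (cvg_cst _) (cpsi x)) (cpd i x)))).
have Cm : Cc (fun x => x ord0 ord0 * (2 * psi x * pd psi ord0 x)).
  apply: (@CcMl _ _ (fun x => x ord0 ord0)); first exact: coord_continuous.
  by apply: CcM => //; exact: CcZ.
have := Rint_pd0 Ch.
have -> : pd h ord0 =
    (fun x => psi x ^+ 2 + x ord0 ord0 * (2 * psi x * pd psi ord0 x)).
  by apply/funext => x; rewrite dhE /dh eqxx mul1r.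
rewrite RintD//; last exact: CcX2.
have C2 := CcX2 Ccpsi; have C3 := CcX2 Ccpd.
have : Rint (fun x => (- 1) * (x ord0 ord0 * (2 * psi x * pd psi ord0 x))) <=
    Rint (fun x => 2^-1 * psi x ^+ 2 + (2 * L ^+ 2) * pd psi ord0 x ^+ 2).
  apply: le_Rint; [exact: CcZ|by apply: CcD; exact: CcZ|move=> x].
  have [Kx|nKx] := pselect (K x); last first.
    by rewrite psi0// dpsi0// expr0n !mulr0 addr0.
  have xL : x ord0 ord0 ^+ 2 <= L ^+ 2.
    by rewrite -real_normK ?num_real// lerXn2r ?nnegrE// ?Omega_bounded//;
      [exact: le_trans (Omega_bounded (KO _ Kx))|exact: KO].
  have H : x ord0 ord0 ^+ 2 * pd psi ord0 x ^+ 2 <= L ^+ 2 * pd psi ord0 x ^+ 2.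
    by rewrite ler_wpM2r// sqr_ge0.
  (* Young's inequality: -2 x_0 psi d_0 psi <= psi^2 / 2 + 2 x_0^2 (d_0 psi)^2. Absorbing the half
     on the left then yields the constant 4 L^2. *)
  have := sqr_ge0 (psi x + 2 * (x ord0 ord0 * pd psi ord0 x)); nra.
rewrite RintZ// RintD; [|exact: CcZ|exact: CcZ].
rewrite RintZ// RintZ//; lra.
Qed.

Definition excess (sg : R) phi x : R := soft_pos (sg * phi x - w (x ord0 ord0)).

Let df (sg : R) phi (i : 'I_m.+1) x : R :=
  sg * pd phi i x - (i == ord0)%:R * dw (x ord0 ord0).

(** Off the compact set carrying [phi] the argument is -w <= 0, where [soft_pos] and its derivative
    vanish; so the same compact set carries the excess. *)
Lemma C1c_excess (sg : R) phi : C1c Omega phi ->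
  C1c Omega (excess sg phi) /\ forall i x, pd (excess sg phi) i x =
    dsoft_pos (sg * phi x - w (x ord0 ord0)) * df sg phi i x.
Proof.
move=> Cphi; have [K [cK KO phi0 dphi0]] := C1c_pd0 Cphi.
apply: (@C1c_local _ _ _ K) => //.
- by move=> x nKx; rewrite /excess phi0// mulr0 sub0r soft_pos_le0// oppr_le0.
- by move=> i x nKx; rewrite phi0// mulr0 sub0r dsoft_pos_le0 ?oppr_le0// mul0r.
- move=> i x Ox.
  have H1 := is_derive_comp_dir (is_derive_coord i ord0 x) (is_derive_w Ox).
  have H2 := is_deriveB (is_deriveZ sg (C1c_is_derive i x Cphi)) H1.
  have := is_derive_comp_dir H2 (is_derive_soft_pos _).
  by move/is_derive_eq; apply; rewrite [dw _ * _]mulrC.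
- move=> i x Ox.
  have cdw := continuous_coord0 (is_derive_dw Ox).
  have cw := continuous_coord0 (is_derive_w Ox).
  have [_ [cpd _]] := Cphi; have [cphi _] := C1c_Cc Cphi.
  have cf : {for x, continuous (fun x => sg * phi x - w (x ord0 ord0))}.
    exact: (cvgB (cvgM (cvg_cst sg) (cphi x)) cw).
  have ct : {for x, continuous (fun x => dsoft_pos (sg * phi x - w (x ord0 ord0)))}.
    by apply: continuous_comp; [exact: cf|exact: continuous_dsoft_pos].
  exact: (cvgM ct (cvgB (cvgM (cvg_cst sg) (cpd i x)) (cvgM (cvg_cst _) cdw))).
Qed.

Lemma excess_ge0 (sg : R) phi x : 0 <= excess sg phi x.
Proof. exact: soft_pos_ge0. Qed.

(* With f := sg phi_n - w and psi := soft_pos f, the integral of grad f . grad psi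
   controls that of |grad psi|^2, because 0 <= dsoft_pos <= 1. *)
Lemma excess_energy_le (sg : R) (phi : nat -> 'rV[R]_m.+1 -> R) (n N : nat)
    (e l : R) :
  sg ^+ 2 = 1 -> (forall k, C1c Omega (phi k)) ->
  (forall k, (N <= k)%N ->
    Rint (grad_sq (fun y => phi n y - phi k y)) <= e) ->
  (fun k => Rint (grad_dot (phi k) (excess sg (phi n)))) @ \oo --> l ->
  sg * l <= Rint (excess sg (phi n)) ->
  Rint (fun x => excess sg (phi n) x ^+ 2) <= 4 * L ^+ 2 * e.
Proof.
move=> sg1 Cphi cauchy; set psi := excess sg (phi n) => lim_psi l_le.
have [Cpsi dpsi] : C1c Omega psi /\ forall i x, pd psi i x =
    dsoft_pos (sg * phi n x - w (x ord0 ord0)) * df sg (phi n) i x.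
  exact: C1c_excess.
(* [E] is grad f . grad psi. After integration its [w] part becomes the integral of [psi], by
   [Rint_dw_pd]. *)
pose E x := sg * grad_dot (phi n) psi x - dw (x ord0 ord0) * pd psi ord0 x.
have EE x : E x = \sum_i df sg (phi n) i x * pd psi i x.
  rewrite /E /grad_dot mulr_sumr.
  under [RHS]eq_bigr do rewrite mulrBl.
  rewrite sumrB; congr (_ - _).
    by apply: eq_bigr => i _; rewrite mulrA.
  rewrite (bigD1 ord0)//= ?eqxx mul1r big1 ?addr0// => i /negbTE ->.
  by rewrite !mul0r.
have C1 k : Cc (grad_dot (phi k) psi) by exact: Cc_grad_dot (Cphi k) Cpsi.
have CE : Cc E by apply: CcB; [exact: CcZ|exact: Cc_dw_pd].
have RE : Rint E = sg * Rint (grad_dot (phi n) psi) - Rint psi.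
  rewrite RintB; [|exact: CcZ|exact: Cc_dw_pd].
  by rewrite RintZ// Rint_dw_pd.
(* As d_i psi = t d with 0 <= t <= 1, this is t^2 d^2 <= t d^2. *)
have sq_le i x : pd psi i x ^+ 2 <= df sg (phi n) i x * pd psi i x.
  rewrite dpsi; set t := dsoft_pos _; set d := df _ _ _ _.
  have t0 : 0 <= t by exact: dsoft_pos_ge0.
  have t1 : t <= 1 by exact: dsoft_pos_le1.
  have d2 : 0 <= d ^+ 2 by exact: sqr_ge0.
  have : 0 <= t * (1 - t) * d ^+ 2.
    by apply: mulr_ge0 => //; apply: mulr_ge0 => //; rewrite subr_ge0.
  nra.
have E_ge x : pd psi ord0 x ^+ 2 <= E x.
  rewrite EE (bigD1 ord0)//= (le_trans (sq_le _ _))// lerDl sumr_ge0// => i _.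
  exact: le_trans (sqr_ge0 _) (sq_le _ _).
(* Trades phi_n for phi_k, for which the limit in k is known. With a - b the partial derivative of
   phi_n - phi_k, Young's inequality weighted by t <= 1 gives sg t d (a - b) <= (t d^2 + (a - b)^2)
   / 2. *)
have key k x : sg * grad_dot (phi n) psi x <= sg * grad_dot (phi k) psi x +
    (2^-1 * E x + 2^-1 * grad_sq (fun y => phi n y - phi k y) x).
  have [_ dB] := C1cB (Cphi n) (Cphi k).
  rewrite EE /grad_dot /grad_sq !mulr_sumr -!big_split/=; apply: ler_sum => i _.
  rewrite dB dpsi; set t := dsoft_pos _; set d := df _ _ _ _.
  set a := pd _ _ _; set b := pd _ _ _.
  have t0 : 0 <= t by exact: dsoft_pos_ge0.
  have t1 : t <= 1 by exact: dsoft_pos_le1.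
  have H1 : 0 <= t * (d - sg * (a - b)) ^+ 2 by rewrite mulr_ge0// sqr_ge0.
  have H2 : 0 <= (1 - t) * (a - b) ^+ 2 by rewrite mulr_ge0 ?sqr_ge0// subr_ge0.
  have H3 : (d - sg * (a - b)) ^+ 2 =
      d ^+ 2 - 2 * sg * d * (a - b) + (a - b) ^+ 2.
    by rewrite sqrrB exprMn sg1; ring.
  rewrite H3 in H1; nra.
have CS k : Cc (grad_sq (fun y => phi n y - phi k y)).
  by have [CB _] := C1cB (Cphi n) (Cphi k); exact: Cc_grad_sq CB.
have keyR k : (N <= k)%N -> sg * Rint (grad_dot (phi n) psi) <=
    sg * Rint (grad_dot (phi k) psi) + (2^-1 * Rint E + 2^-1 * e).
  move=> Nk; have := le_Rint _ _ (key k).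
  have CH : Cc (fun x => 2^-1 * E x +
      2^-1 * grad_sq (fun y => phi n y - phi k y) x) by apply: CcD; exact: CcZ.
  have CH2 : Cc (fun x => sg * grad_dot (phi k) psi x) by exact: CcZ.
  have CH3 : Cc (fun x => sg * grad_dot (phi n) psi x) by exact: CcZ.
  move=> /(_ CH3 (CcD CH2 CH)).
  rewrite (RintD CH2 CH) RintZ// RintZ//.
  rewrite RintD; [|exact: CcZ|exact: CcZ]; rewrite RintZ// RintZ//.
  move=> /le_trans; apply; rewrite !lerD2l ler_wpM2l ?invr_ge0//; exact: cauchy.
have : sg * Rint (grad_dot (phi n) psi) <=
    sg * l + (2^-1 * Rint E + 2^-1 * e).
  apply: (@cvgr_to_ge _ \oo _ _
    (fun k => sg * Rint (grad_dot (phi k) psi) + (2^-1 * Rint E + 2^-1 * e))).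
    apply: cvgD; last exact: cvg_cst.
    by apply: cvgM; [exact: cvg_cst|exact: lim_psi].
  by exists N.
(* By the limit, Rint E <= (sg l - Rint psi) + (Rint E + e) / 2, where the first bracket is at most
   0; half of [Rint E] is absorbed. *)
move=> lim_le; have RE_le : Rint E <= e by rewrite RE in lim_le *; lra.
apply: (le_trans (poincare_coord0 Cpsi)); apply: ler_wpM2l.
  by apply: mulr_ge0 => //; exact: sqr_ge0.
apply: le_trans RE_le; apply: le_Rint => //.
by apply: CcX2; exact: C1c_Cc_pd Cpsi.
Qed.

End comparison.

(** * Passage to the limit and almost everywhere comparison *)

Section ae_comparison.
Context {R : realType}.

Lemma integ_ge0 (m : nat) (f : 'rV[R]_m -> \bar R) :
  (forall x, 0 <= f x)%E -> (0 <= integ f)%E.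
Proof.
elim: m f => [|m IH] f f0 /=; first exact: f0.
by apply: integral_ge0 => x _; apply: IH.
Qed.

Lemma cvge0_near_le (f : nat -> \bar R) (e : R) :
  f @ \oo --> 0%E -> 0 < e -> \forall n \near \oo, (f n <= e%:E)%E.
Proof.
move=> /fine_cvgP[fin cv] e0.
have H := cvgr_le 0 cv e e0.
near=> n; have fn : f n \is a fin_num by near: n.
by rewrite -(fineK fn) lee_fin; near: n; exact: H.
Unshelve. all: by end_near. Qed.

Lemma ae_zero_of_sq_le (m : nat) (g : m.-tuple R -> R) :
  measurable_fun [set: m.-tuple R] g ->
  (forall e : R, 0 < e -> (\int[leb_tuple m]_t (g t ^+ 2)%:E <= e%:E)%E) ->
  {ae leb_tuple m, forall t, g t = 0}.
Proof.
move=> mg small.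
have mg2 : measurable_fun [set: m.-tuple R] (fun t => (g t ^+ 2)%:E).
  by apply/measurable_EFinP; exact: measurable_funX.
have int0 : (\int[leb_tuple m]_t `|(g t ^+ 2)%:E| = 0)%E.
  rewrite (eq_integral (fun t => (g t ^+ 2)%:E)); last first.
    by move=> t _; rewrite gee0_abs// lee_fin sqr_ge0.
  apply/eqP; rewrite eq_le; apply/andP; split; last first.
    by apply: integral_ge0 => t _; rewrite lee_fin sqr_ge0.
  by apply/lee_addgt0Pr => e e0; rewrite add0e; exact: small.
have /(ae_eq_integral_abs _ measurableT mg2) := int0.
apply: filterS => t /(_ I) /= [] /eqP.
by rewrite sqrf_eq0 => /eqP.
Qed.

(** Off [Omega] every phi_n vanishes, so there u^2 = (phi_n - u)^2, whose integral tends to 0. The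
    barrier depends on x_0 alone and cannot by itself force [u] to vanish where another coordinate
    leaves ]0,1[. *)
Lemma H01_approx_ae_zero (m : nat) (Omega : set 'rV[R]_m) phi u :
  open Omega -> H01_approx Omega phi u ->
  {ae leb_tuple m, forall t, ~ Omega (rV_of_tuple t) -> u (rV_of_tuple t) = 0}.
Proof.
move=> oO [Cphi _ mu cvg_u].
have mO := measurable_rV_open oO.
set D := @rV_of_tuple R m @^-1` Omega in mO.
pose g (t : m.-tuple R) := u (rV_of_tuple t) * \1_(~` D) t.
have mg : measurable_fun [set: m.-tuple R] g.
  apply: measurable_funM => //; apply: measurable_indic; exact: measurableC.
have : {ae leb_tuple m, forall t, g t = 0}.
  apply: ae_zero_of_sq_le => // e e0.
  have [n _ /(_ n (leqnn n)) /= H] := cvge0_near_le cvg_u e0.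
  have mphi : borel_fun (phi n).
    by apply: continuous_borel_fun; have [] := C1c_Cc (Cphi n).
  have md : measurable_fun [set: m.-tuple R]
      (fun t => ((phi n (rV_of_tuple t) - u (rV_of_tuple t)) ^+ 2)%:E).
    apply/measurable_EFinP; apply: measurable_funX.
    exact: (measurable_funB mphi mu).
  apply: le_trans H; rewrite integ_ge0E//; last first.
    by move=> x; rewrite lee_fin sqr_ge0.
  apply: ge0_le_integral => //.
  - by move=> t _; rewrite lee_fin sqr_ge0.
  - by apply/measurable_EFinP; exact: measurable_funX.
  - move=> t _; rewrite lee_fin /g indicE in_setC.
    case: (boolP (t \in D)) => /=; first by rewrite mulr0 expr0n sqr_ge0.
    rewrite notin_setE mulr1 => tD.
    have [_ [_ [K [_ KO phi0]]]] := Cphi n.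
    by rewrite phi0 ?sub0r ?sqrrN// => /KO.
apply: filterS => t + nO.
by rewrite /g indicE mem_set ?mulr1.
Qed.

(** The L^2 bound on the excess of phi_n passes to [u] because [soft_pos] is 1-Lipschitz: the two
    excesses differ by at most |phi_n - u|, which is small in L^2. *)
Lemma torsion_compare_ae (m : nat) (Omega : set 'rV[R]_m.+1) (w dw : R -> R)
    (L sg : R) phi u :
  (forall s, 0 <= w s) -> continuous w ->
  (forall x : 'rV[R]_m.+1, Omega x ->
     is_derive (x ord0 ord0) 1 w (dw (x ord0 ord0))) ->
  (forall x : 'rV[R]_m.+1, Omega x -> is_derive (x ord0 ord0) 1 dw (-1)) ->
  (forall x : 'rV[R]_m.+1, Omega x -> `|x ord0 ord0| <= L) ->
  sg ^+ 2 = 1 -> H01_approx Omega phi u ->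
  (forall psi, C1c Omega psi ->
     (fun n => integ (fun x => (grad_dot (phi n) psi x)%:E)) @ \oo -->
       integ (fun x => (psi x)%:E)) ->
  {ae leb_tuple m.+1, forall t, sg * u (rV_of_tuple t) <= w (tnth t ord0)}.
Proof.
move=> w0 cw wdw ddw OL sg1 [Cphi cauchy mu cvg_u] weak.
have mcmp f : borel_fun f -> measurable_fun [set: m.+1.-tuple R]
    (fun t => excess w sg f (rV_of_tuple t)).
  move=> mf; apply: measurableT_comp.
    by apply: continuous_measurable_fun; exact: continuous_soft_pos.
  apply: measurable_funB; first exact: (measurable_funM (measurable_cst _) mf).
  apply: (@continuous_borel_fun _ _ (fun x : 'rV[R]_m.+1 => w (x ord0 ord0))).
  by move=> x; apply: continuous_comp; [exact: coord_continuous|exact: cw].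
suff : {ae leb_tuple m.+1, forall t, excess w sg u (rV_of_tuple t) = 0}.
  apply: filterS => t /soft_pos_eq0; rewrite subr_le0; congr (_ <= w _).
  by rewrite mxE.
apply: ae_zero_of_sq_le; first exact: mcmp.
move=> e e0.
(* Chosen so that 2 (4 L^2 e1 + e1) = e, the bound reached at the end; the added 1 keeps the
   denominator positive when L = 0. *)
pose e1 := e / (2 * (4 * L ^+ 2 + 1)).
have L0 : 0 < 4 * L ^+ 2 + 1 by rewrite ltr_wpDl// mulr_ge0// sqr_ge0.
have e10 : 0 < e1 by rewrite divr_gt0// mulr_gt0.
have [N HN] := cauchy _ e10.
have [N' _ HN'] := cvge0_near_le cvg_u e10.
pose n := maxn N N'.
have Cpsi : C1c Omega (excess w sg (phi n)).
  by have [] := C1c_excess w0 wdw ddw sg (Cphi n).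
pose psi := excess w sg (phi n).
have Hpsi : Rint (fun x => psi x ^+ 2) <= 4 * L ^+ 2 * e1.
  apply: (@excess_energy_le _ _ Omega w dw L w0 wdw ddw OL sg phi n N e1
    (Rint psi)) => //.
  - move=> k Nk; rewrite -lee_fin -integ_Cc; last first.
      by have [CB _] := C1cB (Cphi n) (Cphi k); exact: Cc_grad_sq CB.
    apply/ltW/(le_lt_trans _ (HN n k (leq_maxl _ _) Nk)).
    by rewrite leeDr// integ_ge0// => x; rewrite lee_fin sqr_ge0.
  - have := weak _ Cpsi; rewrite (integ_Cc (C1c_Cc Cpsi)) => /fine_cvg.
    rewrite (_ : fine \o _ = (fun k => Rint (grad_dot (phi k) psi)))//.
    by apply/funext => k; rewrite /comp integ_Cc//; exact: Cc_grad_dot (Cphi k) Cpsi.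
  (* The weak equation makes the limit equal to [Rint psi]; this integral is nonnegative, so the
     required inequality holds for sg = -1 as well as for sg = 1. *)
  - have p0 : 0 <= Rint psi by apply: Rint_ge0 => x; exact: excess_ge0.
    have s1 : sg <= 1 by have := sqr_ge0 (sg - 1); nra.
    by rewrite ler_piMl.
have Hd := HN' n (leq_maxr _ _).
have mphi : borel_fun (phi n).
  by apply: continuous_borel_fun; have [] := C1c_Cc (Cphi n).
have md : measurable_fun [set: m.+1.-tuple R]
    (fun t => (phi n (rV_of_tuple t) - u (rV_of_tuple t)) ^+ 2).
  by apply: measurable_funX; exact: (measurable_funB mphi mu).
have mp : measurable_fun [set: m.+1.-tuple R]
    (fun t => psi (rV_of_tuple t) ^+ 2).
  by apply: measurable_funX; exact: mcmp.
have Hd' : (\int[leb_tuple m.+1]_t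
    ((phi n (rV_of_tuple t) - u (rV_of_tuple t)) ^+ 2)%:E <= e1%:E)%E.
  rewrite -(@integ_ge0E _ _ (fun x => ((phi n x - u x) ^+ 2)%:E))//.
    exact/measurable_EFinP.
  by move=> x; rewrite lee_fin sqr_ge0.
have Hp' : (\int[leb_tuple m.+1]_t (psi (rV_of_tuple t) ^+ 2)%:E <=
    (4 * L ^+ 2 * e1)%:E)%E.
  rewrite -(@integ_ge0E _ _ (fun x => (psi x ^+ 2)%:E))//.
  - by rewrite integ_Cc ?lee_fin//; apply/CcX2/(C1c_Cc Cpsi).
  - exact/measurable_EFinP.
  - by move=> x; rewrite lee_fin sqr_ge0.
apply: (@le_trans _ _ (\int[leb_tuple m.+1]_t
   (2%:E * ((psi (rV_of_tuple t) ^+ 2)%:E +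
    ((phi n (rV_of_tuple t) - u (rV_of_tuple t)) ^+ 2)%:E))))%E.
  apply: ge0_le_integral => //.
  - by move=> t _; rewrite lee_fin sqr_ge0.
  - by apply/measurable_EFinP; apply: measurable_funX; exact: mcmp.
  - apply: emeasurable_funM => //; apply: emeasurable_funD; exact/measurable_EFinP.
  - move=> t _; rewrite -EFinD -EFinM lee_fin.
    set a := excess _ _ _ _; set b := psi _; set c := phi n _ - _.
    have : `|a - b| <= `|c|.
      rewrite /a /b /psi /excess (le_trans (soft_pos_lipschitz _ _))//.
      rewrite opprB addrA subrK -mulrBr normrM /c distrC.
      suff -> : `|sg| = 1 by rewrite mul1r.
      by apply/eqP; rewrite -(@pexpr_eq1 _ _ 2)// real_normK ?num_real// sg1.
    move=> ab; have : (a - b) ^+ 2 <= c ^+ 2.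
      rewrite -[leLHS]real_normK ?num_real// -[leRHS]real_normK ?num_real//.
      by rewrite lerXn2r ?nnegrE.
    (* 2 b^2 + 2 (a - b)^2 - a^2 = (a - 2 b)^2. *)
    have := sqr_ge0 (a - 2 * b); nra.
rewrite ge0_integralZl//; last 2 first.
- by apply: emeasurable_funD; exact/measurable_EFinP.
- by move=> t _; rewrite -EFinD lee_fin addr_ge0// sqr_ge0.
rewrite ge0_integralD//; first last.
- exact/measurable_EFinP.
- by move=> t _; rewrite lee_fin sqr_ge0.
- exact/measurable_EFinP.
- by move=> t _; rewrite lee_fin sqr_ge0.
apply: (@le_trans _ _ (2%:E * ((4 * L ^+ 2 * e1)%:E + e1%:E)))%E.
  by apply: lee_wpmul2l; [rewrite lee_fin|exact: leeD].
rewrite -EFinD -EFinM lee_fin /e1.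
rewrite -{2}(mul1r (e / _)) -mulrDl mulrA mulrCA divff ?mulr1// gt_eqF//.
exact: mulr_gt0.
Qed.

End ae_comparison.

(** * Slabs *)

Section cylinder.
Context {R : realType}.

Definition box (m : nat) : set 'rV[R]_m := [set x | forall i, 0 < x ord0 i < 1].

Definition cyl (m : nat) (A : set R) : set 'rV[R]_m.+1 :=
  [set x | A (x ord0 ord0) /\ forall i : 'I_m, 0 < x ord0 (lift ord0 i) < 1].

Lemma boxS m : @box m.+1 = @cyl m `]0, 1[%classic.
Proof.
rewrite predeqE => x; split => [bx|[/= + bx] i].
  by split => [|i]; [rewrite /= in_itv/=; exact: bx|exact: bx].
rewrite in_itv/= => x0.
by case: (unliftP ord0 i) => [j ->|->]; [exact: bx|exact: x0].
Qed.

Lemma cyl_row_mx m (A : set R) (x : R) (s : 'rV[R]_m) :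
  cyl A (row_mx (x%:M : 'rV[R]_1) s : 'rV[R]_m.+1) <-> A x /\ box s.
Proof.
have E0 : (row_mx (x%:M : 'rV[R]_1) s : 'rV[R]_m.+1) ord0 ord0 = x.
  transitivity (row_mx (x%:M : 'rV[R]_1) s ord0 (lshift m ord0)).
    by congr (fun_of_matrix _ _ _); exact/val_inj.
  by rewrite row_mxEl mxE eqxx.
have Ei i : (row_mx (x%:M : 'rV[R]_1) s : 'rV[R]_m.+1) ord0 (lift ord0 i) =
    s ord0 i.
  rewrite -(row_mxEr (x%:M : 'rV[R]_1) s).
  by congr (fun_of_matrix _ _ _); exact/val_inj.
rewrite /cyl /box /= E0; split=> -[Ax bs]; split => // i.
  by rewrite -Ei.
by rewrite Ei.
Qed.

Lemma integ0 m : integ (fun _ : 'rV[R]_m => 0%E) = 0%E.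
Proof.
elim: m => //= m IH; under eq_integral do rewrite IH; exact: integral0.
Qed.

Lemma leb_cyl_box m (A : set R) : measurable A -> leb (@box m) = 1%E ->
  leb (@cyl m A) = lebesgue_measure A.
Proof.
move=> mA lb; rewrite /leb /=.
transitivity (\int[lebesgue_measure]_x (\1_A x)%:E)%E; last first.
  by rewrite integral_indic// setIT.
apply: eq_integral => x _.
have [Ax|nAx] := pselect (A x).
  rewrite indicE mem_set// -lb /leb; congr integ; apply/funext => s.
  rewrite !indicE; congr ((nat_of_bool _)%:R%:E); apply/idP/idP; rewrite !inE => H.
    by have [] := (cyl_row_mx A x s).1 H.
  exact: (cyl_row_mx A x s).2 (conj Ax H).
rewrite indicE memNset// -[RHS](integ0 m); congr integ; apply/funext => s.
by rewrite indicE memNset// => /cyl_row_mx[].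
Qed.

Lemma leb_box m : leb (@box m) = 1%E.
Proof.
elim: m => [|m IH]; first by rewrite /leb /= indicE mem_set// => -[].
rewrite boxS leb_cyl_box//.
by rewrite lebesgue_measure_itv/= lte_fin ltr01 sube0.
Qed.

Lemma leb_cyl m (A : set R) : measurable A ->
  leb (@cyl m A) = lebesgue_measure A.
Proof. by move=> mA; apply: leb_cyl_box => //; exact: leb_box. Qed.

Lemma open_cyl m (A : set R) : open A -> open (@cyl m A).
Proof.
move=> oA; have -> : @cyl m A = (fun x : 'rV[R]_m.+1 => x ord0 ord0) @^-1` A `&`
    [set x | forall i : 'I_m, 0 < x ord0 (lift ord0 i) < 1] by [].
apply: openI.
  by apply: open_comp => // x _; exact: coord_continuous.
rewrite openE => x xi.
apply: (@filter_forall _ _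
  (fun i (y : 'rV[R]_m.+1) => is_true (0 < y ord0 (lift ord0 i) < 1))
  (nbhs x)) => i.
have : open ((fun x : 'rV[R]_m.+1 => x ord0 (lift ord0 i)) @^-1` `]0, 1[%classic).
  by apply: open_comp; [move=> y _; exact: coord_continuous|exact: interval_open].
rewrite openE => /(_ x); rewrite /= in_itv/= => /(_ (xi i)).
by apply: filterS => y; rewrite /= in_itv.
Qed.

Lemma measurable_cyl m (A : set R) : open A ->
  measurable (@rV_of_tuple R m.+1 @^-1` @cyl m A).
Proof. by move=> oA; apply: measurable_rV_open; exact: open_cyl. Qed.

End cylinder.

(** * The one-dimensional barrier on a union of disjoint intervals *)

Section slabs.
Context {R : realType} (t : nat -> R).
Hypothesis t_lt : forall j, t j < t j.+1.
Variable N : nat.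

Let t_homo : {homo t : i j / (i < j)%N >-> i < j}.
Proof. by apply: homo_ltn => //; exact: lt_trans. Qed.

Let t_le : {homo t : i j / (i <= j)%N >-> i <= j}.
Proof. by move=> i j; rewrite leq_eqVlt => /predU1P[->//|/t_homo/ltW]. Qed.

Definition slab (j : nat) : set R := `]t j, t j.+1[%classic.
Definition slabs : set R := [set s | exists j : 'I_N, slab j s].

(** On each slab this is the solution of -w'' = 1 with zero boundary values. At any point at most
    one product is positive, so the maxima make the sum nonnegative and continuous on the whole
    line, with kinks only at the knots, which lie outside [slabs]. *)
Definition barrier (s : R) : R :=
  2^-1 * \sum_(j < N) Num.max ((s - t j) * (t j.+1 - s)) 0.
Definition dbarrier (s : R) : R :=
  \sum_(j < N) \1_(slab j) s * ((t j + t j.+1) / 2 - s).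

Lemma slab_other (i j : nat) s : slab j s -> i <> j ->
  ~ slab i s /\ (s - t i) * (t i.+1 - s) <= 0.
Proof.
rewrite /slab/= !in_itv/= => /andP[js sj] ij.
have [lt_ij|ge_ij] := ltnP i j.
  have ti := t_le lt_ij; split.
    by rewrite (ltNge s) (le_trans ti (ltW js)) andbF.
  have := t_lt i; nra.
have lt_ji : (j < i)%N by rewrite ltn_neqAle ge_ij andbT; apply/eqP => /esym.
have ti := t_le lt_ji; split.
  by rewrite (ltNge _ s) (le_trans (ltW sj) ti).
have := t_lt i; nra.
Qed.

Lemma barrierE (j : 'I_N) s : slab j s ->
  barrier s = 2^-1 * ((s - t j) * (t j.+1 - s)).
Proof.
move=> js; rewrite /barrier (bigD1 j)//= big1 ?addr0.
  by rewrite max_l//; move: js; rewrite /slab/= in_itv/= => /andP[? ?]; nra.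
move=> i ij; rewrite max_r//; apply: (slab_other js _).2.
by move=> /val_inj ij'; rewrite ij' eqxx in ij.
Qed.

Lemma dbarrierE (j : 'I_N) s : slab j s ->
  dbarrier s = (t j + t j.+1) / 2 - s.
Proof.
move=> js; rewrite /dbarrier (bigD1 j)//= big1 ?addr0.
  by rewrite indicE mem_set// mul1r.
move=> i ij; rewrite indicE memNset ?mul0r//; apply: (slab_other js _).1.
by move=> /val_inj ij'; rewrite ij' eqxx in ij.
Qed.

Lemma indic_slabs s : \1_slabs s = \sum_(j < N) \1_(slab j) s :> R.
Proof.
rewrite indicE; have [/[dup] Us [j js]|nUs] := pselect (slabs s).
  rewrite mem_set// (bigD1 j)//= big1 ?addr0; first by rewrite indicE mem_set.
  move=> i ij; rewrite indicE memNset//; apply: (slab_other js _).1.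
  by move=> /val_inj ij'; rewrite ij' eqxx in ij.
rewrite memNset// big1// => j _; rewrite indicE memNset// => js.
by apply: nUs; exists j.
Qed.

Lemma barrier_ge0 s : 0 <= barrier s.
Proof. by rewrite mulr_ge0// sumr_ge0// => j _; rewrite le_max lexx orbT. Qed.

Lemma continuous_barrier : continuous barrier.
Proof.
move=> s; apply: cvgM; first exact: cvg_cst.
apply: cvg_big => [|j _]; first exact: add_continuous.
have c1 : {for s, continuous (fun s => (s - t j) * (t j.+1 - s))}.
  apply: cvgM; apply: cvgB; [exact: cvg_id|exact: cvg_cst| |exact: cvg_id].
  exact: cvg_cst.
exact: (continuous_comp c1 (@continuous_max0 R _)).
Qed.

Lemma open_slabs : open slabs.
Proof.
have -> : slabs = \bigcup_(j in [set: 'I_N]) slab j.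
  by rewrite predeqE => s; split => [[j js]|[j _ js]]; exists j.
by apply: bigcup_open => j _; exact: interval_open.
Qed.

Let near_slab (j : 'I_N) s : slab j s -> \forall y \near s, slab j y.
Proof.
move=> js; have : open_nbhs s (slab j) by split=> //; exact: interval_open.
exact: open_nbhs_nbhs.
Qed.

Lemma is_derive_barrier s : slabs s -> is_derive s 1 barrier (dbarrier s).
Proof.
move=> [j js]; rewrite (dbarrierE js).
apply: (@near_eq_is_derive _ _ _ (fun y => 2^-1 * ((y - t j) * (t j.+1 - y)))).
  by apply: filterS (near_slab js) => y yj; rewrite (barrierE yj).
have H1 : is_derive s 1 (@id R - cst (t j)) (1 - 0) by exact: is_deriveB.
have H2 : is_derive s 1 (cst (t j.+1) - @id R) (0 - 1) by exact: is_deriveB.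
have := is_deriveZ 2^-1 (is_deriveM H1 H2).
move/is_derive_eq; apply.
rewrite subr0 sub0r /GRing.scale/= mulr1 !fctE; lra.
Qed.

Lemma is_derive_dbarrier s : slabs s -> is_derive s 1 dbarrier (-1).
Proof.
move=> [j js].
apply: (@near_eq_is_derive _ _ _ (fun y => (t j + t j.+1) / 2 - y)).
  by apply: filterS (near_slab js) => y yj; rewrite (dbarrierE yj).
have H2 : is_derive s 1 (cst ((t j + t j.+1) / 2) - @id R) (0 - 1).
  exact: is_deriveB.
by move/is_derive_eq : H2; apply; rewrite sub0r.
Qed.

Lemma barrier_le (j : 'I_N) s : slab j s -> barrier s <= (t j.+1 - t j) ^+ 2.
Proof.
move=> js; rewrite (barrierE js); move: js; rewrite /slab/= in_itv/= => /andP[js sj].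
have := sqr_ge0 (s - t j - (t j.+1 - s)); nra.
Qed.

Lemma slab_measure j : lebesgue_measure (slab j) = (t j.+1 - t j)%:E.
Proof. by rewrite /slab lebesgue_measure_itv/= lte_fin t_lt EFinB. Qed.

Lemma slabs_measure : lebesgue_measure slabs = (t N - t 0)%:E.
Proof.
have mU : measurable slabs by apply: open_measurable; exact: open_slabs.
transitivity (\int[lebesgue_measure]_x (\1_slabs x)%:E)%E.
  by rewrite integral_indic// setIT.
under eq_integral do rewrite indic_slabs -sumEFin.
rewrite ge0_integral_sum//; last first.
  move=> j; apply/measurable_EFinP; apply: measurable_indic.
  exact: measurable_itv.
rewrite -(telescope_sumr t (leq0n N)) big_mkord -sumEFin.
apply: eq_bigr => j _; rewrite integral_indic//; last exact: measurable_itv.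
by rewrite setIT; exact: slab_measure.
Qed.

(** On a slab of length d <= 1, |u| <= d^2 <= 1 and hence |u|^p <= |u| <= d^2, since p >= 1; the
    cylinder over the slab has measure d, whence d^3. *)
Lemma torsion_Lp_le (m : nat) (p : R) (u : 'rV[R]_m.+1 -> R) :
  1 <= p -> (forall j, t j.+1 - t j <= 1) -> torsion_sol (@cyl R m slabs) u ->
  (integ (fun x => (`|u x| `^ p)%:E) <=
     (\sum_(j < N) (t j.+1 - t j) ^+ 3)%:E)%E.
Proof.
move=> p1 t1 [phi [approx weak]].
have p0 : 0 < p by exact: lt_le_trans p1.
have oU := @open_cyl R m _ open_slabs.
(* All slabs lie between t_0 and t_N; this supplies the constant of the Poincare inequality. *)
have slabL s : slabs s -> `|s| <= `|t 0%N| + `|t N|.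
  move=> [j]; rewrite /slab/= in_itv/= => /andP[js sj].
  have h1 := t_le (leq0n j); have h2 := t_le (ltn_ord j).
  have := ler_norm (t N); have := ler_norm (- t 0%N); rewrite normrN.
  have := normr_ge0 (t N); have := normr_ge0 (t 0%N).
  by move=> *; rewrite ler_norml; apply/andP; split; lra.
have u_le sg : sg ^+ 2 = 1 -> {ae leb_tuple m.+1,
    forall s, sg * u (rV_of_tuple s) <= barrier (tnth s ord0)}.
  move=> sg1; apply: (torsion_compare_ae barrier_ge0 continuous_barrier
    (Omega := @cyl R m slabs) (dw := dbarrier) (L := `|t 0%N| + `|t N|)
    _ _ _ sg1 approx weak).
  - by move=> x [Ux _]; exact: is_derive_barrier.
  - by move=> x [Ux _]; exact: is_derive_dbarrier.
  - by move=> x [Ux _]; exact: slabL.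
have ae1 := u_le 1 (expr1n _ _).
have ae2 : {ae leb_tuple m.+1,
    forall s, -1 * u (rV_of_tuple s) <= barrier (tnth s ord0)}.
  by apply: u_le; rewrite sqrrN expr1n.
have ae3 := H01_approx_ae_zero oU approx.
have mu : borel_fun u by case: approx.
have mup : measurable_fun [set: m.+1.-tuple R]
    (fun s => (`|u (rV_of_tuple s)| `^ p)%:E).
  apply/measurable_EFinP.
  apply: (measurableT_comp (measurable_powR p)).
  exact: measurableT_comp.
pose c j := (t j.+1 - t j) ^+ 2.
pose g j (s : m.+1.-tuple R) : \bar R :=
  ((c j)%:E * (\1_(@rV_of_tuple R m.+1 @^-1` @cyl R m (slab j)) s)%:E)%E.
have mc j : measurable (@rV_of_tuple R m.+1 @^-1` @cyl R m (slab j)).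
  by apply: measurable_cyl; exact: interval_open.
have mi j : measurable_fun [set: m.+1.-tuple R]
    (fun s => (\1_(@rV_of_tuple R m.+1 @^-1` @cyl R m (slab j)) s)%:E : \bar R).
  by apply/measurable_EFinP; exact: measurable_indic.
have mg j : measurable_fun [set: m.+1.-tuple R] (g j).
  exact: emeasurable_funM.
have c0 j : 0 <= c j by exact: sqr_ge0.
have g0 j s : (0 <= g j s)%E by rewrite mule_ge0// lee_fin.
rewrite integ_ge0E//.
apply: (@le_trans _ _ (\int[leb_tuple m.+1]_s \sum_(j < N) g j s)%E).
  apply: ae_ge0_le_integral => //.
  - by move=> s _; apply: sume_ge0 => j _.
  - by apply: emeasurable_sum => j; exact: mg.
  have : {ae leb_tuple m.+1, forall s, [/\
      1 * u (rV_of_tuple s) <= barrier (tnth s ord0),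
      -1 * u (rV_of_tuple s) <= barrier (tnth s ord0) &
      ~ @cyl R m slabs (rV_of_tuple s) -> u (rV_of_tuple s) = 0]}.
    by apply: filterS3 ae1 ae2 ae3 => s.
  apply: filterS => s [u1 u2 u3] _.
  have [Os|nOs] := pselect (@cyl R m slabs (rV_of_tuple s)); last first.
    rewrite u3// normr0 powR0 ?gt_eqF//; apply: sume_ge0 => j _; exact: g0.
  have [[j js] bs] := Os.
  rewrite (bigD1 j)//=; apply: (@le_trans _ _ (g j s)); last first.
    by rewrite leeDl//; apply: sume_ge0 => i _.
  rewrite /g indicE mem_set//.
  rewrite -EFinM lee_fin mulr1.
  have js' : slab j (tnth s ord0) by move: js; rewrite mxE.
  have ub : `|u (rV_of_tuple s)| <= c j.
    apply: le_trans (barrier_le js').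
    by rewrite ler_norml; apply/andP; split; lra.
  have cj1 : c j <= 1.
    by rewrite /c expr_le1// subr_ge0 ltW.
  have [->|un0] := eqVneq (u (rV_of_tuple s)) 0.
    by rewrite normr0 powR0// gt_eqF.
  apply: (le_trans _ ub); apply: ge1r_powR => //.
  by rewrite normr_gt0 un0/= (le_trans ub cj1).
rewrite ge0_integral_sum// -sumEFin; apply: lee_sum => j _.
rewrite ge0_integralZl//; last by rewrite lee_fin.
rewrite (_ : integral _ _ _ = leb (@cyl R m (slab j))); last first.
  rewrite /leb integ_ge0E//.
  by apply/measurable_EFinP; exact: measurable_indic (mc j).
rewrite leb_cyl; last exact: measurable_itv.
by rewrite slab_measure -EFinM lee_fin /c -exprSr.
Qed.

End slabs.

(** * The first eigenvalue *)

Section cap.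
Context {R : realType} (m : nat).
Implicit Types x : 'rV[R]_m.

Definition dist_center x : R := \sum_(i < m) (x ord0 i - 2^-1) ^+ 2.

Lemma is_derive_dist_center (i : 'I_m) x :
  is_derive x (evec i) dist_center (2 * (x ord0 i - 2^-1)).
Proof.
have -> : dist_center = \sum_(j < m) (fun x => (x ord0 j - 2^-1) ^+ 2).
  by apply/funext => y; rewrite fct_sumE.
apply: (@is_derive_eq _ _ _ _ _ _ _
  (\sum_(j < m) 2 * (x ord0 j - 2^-1) * (i == j)%:R)).
  apply: is_derive_sum => j.
  have := is_deriveX 2 (is_deriveB (is_derive_coord i j x)
    (is_derive_cst (2^-1 : R) x (evec i))).
  by move/is_derive_eq; apply; rewrite subr0 expr1.
rewrite (bigD1 i)//= eqxx mulr1 big1 ?addr0// => j ji.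
by rewrite eq_sym (negbTE ji) mulr0.
Qed.

Lemma continuous_dist_center : continuous dist_center.
Proof.
apply: continuous_big => [|j _ x]; first exact: add_continuous.
have c1 : {for x, continuous (fun y : 'rV[R]_m => y ord0 j - 2^-1)}.
  exact: (cvgB (@coord_continuous _ _ _ ord0 j x) (cvg_cst _)).
exact: (cvgM c1 c1).
Qed.

(** A truncated paraboloid, squared to make it C^1; it vanishes outside the ball of radius 1/4 about
    the centre of the unit box. *)
Definition cap x : R := pos_sq (16^-1 - dist_center x).
Definition dcap (i : 'I_m) x : R :=
  (2 * Num.max (16^-1 - dist_center x) 0) * (0 - 2 * (x ord0 i - 2^-1)).

Lemma C1c_cap (Omega : set 'rV[R]_m) : @box R m `<=` Omega -> C1c Omega cap.
Proof.
move=> bO.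
pose J : set R := `[4^-1, 3 / 4]%classic.
pose K := [set x : 'rV[R]_m | forall i, J (x ord0 i)].
have cK : compact K.
  by apply: (@rV_compact _ m (fun=> J)) => i; exact: segment_compact.
have out x : ~ K x -> 16^-1 - dist_center x <= 0.
  (* A single coordinate outside [1/4, 3/4] already contributes more than 1/16 to the squared
     distance. *)
  move=> /existsNP[i]; rewrite /J/= in_itv/= => /negP.
  rewrite negb_and -!ltNge => xi.
  rewrite /dist_center (bigD1 i)//=.
  have : 0 <= \sum_(j < m | j != i) (x ord0 j - 2^-1) ^+ 2.
    by apply: sumr_ge0 => j _; exact: sqr_ge0.
  by case/orP : xi => xi s0; nra.
suff [] : C1c Omega cap /\ forall i x, pd cap i x = dcap i x by [].
apply: (@C1c_local _ _ _ K) => //.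
- move=> x Kx; apply: bO => i; have := Kx i; rewrite /J/= in_itv/= => /andP[? ?].
  by apply/andP; split; lra.
- by move=> x /out h; rewrite /cap /pos_sq max_r// expr0n.
- by move=> i x /out h; rewrite /dcap max_r// mulr0 mul0r.
- move=> i x _; have H := is_deriveB (is_derive_cst (16^-1 : R) x (evec i))
    (is_derive_dist_center i x).
  exact: is_derive_comp_dir H (is_derive_pos_sq _).
- move=> i x _.
  have c1 : {for x, continuous (fun y => 16^-1 - dist_center y)}.
    exact: (cvgB (cvg_cst _) (@continuous_dist_center x)).
  have c2 : {for x, continuous (fun y => Num.max (16^-1 - dist_center y) 0)}.
    exact: (continuous_comp c1 (@continuous_max0 R _)).
  exact: (cvgM (cvgM (cvg_cst _) c2) (cvgB (cvg_cst _)
    (cvgM (cvg_cst _) (cvgB (@coord_continuous _ _ _ ord0 i x) (cvg_cst _))))).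
Qed.

Lemma Cc_cap : Cc cap.
Proof. exact: C1c_Cc (C1c_cap (@subset_refl _ _)). Qed.

Lemma Rint_cap_gt0 : 0 < Rint (fun x => cap x ^+ 2).
Proof.
(* On the cube of half-side [r] about the centre the squared distance is at most m r^2 <= 1/64 <=
   1/32, so [cap] is at least (1/32)^2 there, and [c] is the square of this. Using [m.+1] keeps [r]
   meaningful in dimension 0. *)
pose r : R := (8 * m.+1%:R)^-1.
have m0 : 0 < m.+1%:R :> R by rewrite ltr0n.
have r0 : 0 < r by rewrite invr_gt0 mulr_gt0.
pose A : set R := `]2^-1 - r, 2^-1 + r[%classic.
have mA : measurable A by exact: measurable_itv.
have mT := @measurable_tuple_set R m A mA.
pose c : R := ((32^-1) ^+ 2) ^+ 2.
have c0 : 0 < c by rewrite !exprn_gt0.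
have lA : lebesgue_measure A = (r + r)%:E.
  rewrite lebesgue_measure_itv/= lte_fin ltrD2l gtrN// -EFinB.
  by congr (_%:E); ring.
have : (0 < (Rint (fun x => cap x ^+ 2))%:E)%E; last by rewrite lte_fin.
rewrite -integ_Cc; last exact: CcX2 Cc_cap.
have [cb _] := CcX2 Cc_cap.
have mb := continuous_borel_fun cb.
rewrite integ_ge0E//; last 2 first.
- exact/measurable_EFinP.
- by move=> x; rewrite lee_fin sqr_ge0.
apply: (@lt_le_trans _ _
  (\int[leb_tuple m]_t (c%:E * (\1_(@tuple_set R m A) t)%:E))%E).
  rewrite ge0_integralZl//; last first.
  - by rewrite lee_fin ltW.
  - by apply/measurable_EFinP; exact: measurable_indic.
  rewrite integral_indic// setIT [X in (0 < _ * X)%E](leb_tuple_set m mA) lA.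
  by rewrite mule_gt0 ?lte_fin// expe_gt0// lte_fin addr_gt0.
apply: ge0_le_integral => //.
- by move=> t _; rewrite -EFinM lee_fin mulr_ge0// ltW.
- apply: emeasurable_funM => //.
  by apply/measurable_EFinP; exact: measurable_indic.
- exact/measurable_EFinP.
move=> t _; rewrite -EFinM lee_fin indicE.
have [tA|tA] := boolP (t \in _); last by rewrite mulr0 sqr_ge0.
rewrite mulr1 /cap /pos_sq.
have d32 : dist_center (rV_of_tuple t) <= 32^-1.
  apply: (@le_trans _ _ (\sum_(i < m) r ^+ 2)).
    apply: ler_sum => i _; rewrite mxE.
    move: tA; rewrite inE => /(_ i); rewrite /A/= in_itv/= => /andP[h1 h2].
    have : 0 <= (r - (tnth t i - 2^-1)) * (r + (tnth t i - 2^-1)).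
      by apply: mulr_ge0; lra.
    nra.
  rewrite sumr_const card_ord -[leLHS]mulr_natl.
  have mr : m%:R * r <= 8^-1.
    rewrite /r invfM mulrCA ler_piMr// ?invr_ge0// ler_pdivrMr// mul1r.
    by rewrite ler_nat.
  have r8 : r <= 8^-1.
    by rewrite /r invfM ler_piMr ?invr_ge0// invf_le1// ler1n.
  rewrite expr2 mulrA; apply: (@le_trans _ _ (8^-1 * 8^-1)); last by lra.
  by apply: ler_pM => //; rewrite ?mulr_ge0// ltW.
have h : 32^-1 <= Num.max (16^-1 - dist_center (rV_of_tuple t)) 0.
  by rewrite le_max; apply/orP; left; lra.
by rewrite /c !lerXn2r ?nnegrE ?exprn_ge0// (le_trans _ h).
Qed.

End cap.

Section lambda1.
Context {R : realType} (m : nat).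

Lemma H01_approx_cst (Omega : set 'rV[R]_m) f : C1c Omega f ->
  H01_approx Omega (fun=> f) f.
Proof.
move=> Cf; have ff0 : (fun y => f y - f y) = cst 0.
  by apply/funext => y; rewrite subrr.
have i0 : integ (fun x => ((f x - f x) ^+ 2)%:E) = 0%E.
  rewrite -[RHS](integ0 m); congr integ; apply/funext => x.
  by rewrite subrr expr0n.
split => //.
- move=> e e0; exists 0%N => n k _ _; rewrite i0 add0e.
  rewrite (_ : integ _ = 0%E) ?lte_fin//.
  rewrite -[RHS](integ0 m); congr integ; apply/funext => x.
  rewrite ff0 /grad_sq big1// => i _.
  by rewrite (is_derive_pd (is_derive_cst _ _ _)) expr0n.
- by apply: continuous_borel_fun; have [] := C1c_Cc Cf.
- by rewrite i0; exact: cvg_cst.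
Qed.

(** The bound is the Rayleigh quotient of [cap], represented by a constant sequence. Choosing [l]
    before [Omega] is what makes it uniform in M. *)
Lemma lambda1_ub : exists2 l : R, 0 <= l &
  forall Omega : set 'rV[R]_m, @box R m `<=` Omega ->
    (lambda1 Omega <= l%:E)%E.
Proof.
pose f := @cap R m.
have Rf := @Rint_cap_gt0 R m.
exists (Rint (grad_sq f) / Rint (fun x => f x ^+ 2)).
  rewrite divr_ge0 ?(ltW Rf)// Rint_ge0// => x.
  by apply: sumr_ge0 => i _; exact: sqr_ge0.
move=> Omega bO; have Cf := C1c_cap bO.
have if2 : integ (fun x => (f x ^+ 2)%:E) = (Rint (fun x => f x ^+ 2))%:E.
  by rewrite integ_Cc//; exact: CcX2 (C1c_Cc Cf).
apply: ereal_inf_lbound; exists (fun=> f), f; split.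
- exact: H01_approx_cst.
- by rewrite if2 lte_fin.
- rewrite if2 inver gt_eqF// /dirichlet lim_cst; last exact: ereal_hausdorff.
  by rewrite integ_Cc; [rewrite -EFinM|exact: Cc_grad_sq Cf].
Qed.

Lemma lambda1_ge0 (Omega : set 'rV[R]_m) : (0 <= lambda1 Omega)%E.
Proof.
apply: le_ereal_inf_tmp => q [phi [u [_ u0 ->]]].
rewrite mule_ge0 ?inve_ge0 ?(ltW u0)// /dirichlet.
set s := fun n => _.
have s0 n : (0 <= s n)%E.
  apply: integ_ge0 => x; rewrite lee_fin; apply: sumr_ge0 => i _; exact: sqr_ge0.
have [cs|ncs] := pselect (cvg (s @ \oo)).
  by apply: lime_ge => //; exact: nearW.
(* Without a limit, [lim] is the default point of [\bar R], namely 0. *)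
by rewrite dvgP.
Qed.

End lambda1.

(** * The choice of the intervals and the conclusion *)

Section partition.
Context {R : realType} (M : nat).
Hypothesis M0 : (0 < M)%N.

Definition knot (j : nat) : R := if j is k.+1 then 1 + k%:R / M%:R else 0.

Lemma knot_len (j : nat) :
  knot j.+1 - knot j = if j is _.+1 then M%:R^-1 else 1.
Proof.
have MR0 : M%:R != 0 :> R by rewrite pnatr_eq0 -lt0n.
case: j => [|j] /=; first by rewrite mul0r addr0 subr0.
by rewrite -natr1; field.
Qed.

Lemma knot_lt (j : nat) : knot j < knot j.+1.
Proof.
rewrite -subr_gt0 knot_len; case: j => [|j]; first exact: ltr01.
by rewrite invr_gt0 ltr0n.
Qed.

Lemma knot_len_le1 (j : nat) : knot j.+1 - knot j <= 1.
Proof.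
rewrite knot_len; case: j => // j.
by rewrite invf_le1 ?ler1n ?ltr0n.
Qed.

Lemma knot_total : knot (M * M).+1 - knot 0 = 1 + M%:R.
Proof. by rewrite /= subr0 natrM mulfK// pnatr_eq0 -lt0n. Qed.

Lemma sum_knot_len3 :
  \sum_(j < (M * M).+1) (knot j.+1 - knot j) ^+ 3 <= 2.
Proof.
rewrite big_ord_recl knot_len expr1n.
under eq_bigr do rewrite lift0 knot_len.
rewrite sumr_const card_ord -[X in _ + X]mulr_natl natrM.
have MR0 : M%:R != 0 :> R by rewrite pnatr_eq0 -lt0n.
have -> : M%:R * M%:R * M%:R^-1 ^+ 3 = M%:R^-1 :> R by field.
by rewrite -[leRHS](_ : 1 + 1 = 2)// lerD2l invf_le1 ?ler1n ?ltr0n.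
Qed.

Lemma box_sub_knot (m : nat) :
  @box R m.+1 `<=` @cyl R m (slabs knot (M * M).+1).
Proof.
rewrite boxS => x [x0 xi]; split => //; exists ord0.
by move: x0; rewrite /slab /= mul0r addr0.
Qed.

End partition.

Lemma Fp_ge0 (R : realType) (m : nat) (p : R) (Omega : set 'rV[R]_m) :
  0 <= Fp p Omega.
Proof.
rewrite /Fp divr_ge0 ?powR_ge0// mulr_ge0 ?powR_ge0//.
exact/fine_ge0/lambda1_ge0.
Qed.

Lemma fine_le_of_le (R : realType) (x : \bar R) (r : R) :
  0 <= r -> (0 <= x)%E -> (x <= r%:E)%E -> fine x <= r.
Proof. by case: x => [s| |] //=. Qed.

Lemma torsion_Lp_le2 (R : realType) (m M : nat) (p : R) : (0 < M)%N -> 1 <= p ->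
  Lpnorm p (torsion (@cyl R m (slabs (@knot R M) (M * M).+1))) <= 2.
Proof.
move=> M0 p1; have p0 : 0 < p by exact: lt_le_trans p1.
set Omega := cyl _.
have H : fine (integ (fun x => (`|torsion Omega x| `^ p)%:E)) <= 2.
  apply: fine_le_of_le => //.
    by apply: integ_ge0 => x; rewrite lee_fin powR_ge0.
  have [ex|nex] := pselect (exists u, torsion_sol Omega u).
    have sol : torsion_sol Omega (torsion Omega) by exact: xgetPex ex.
    apply: (le_trans (torsion_Lp_le (knot_lt M0) p1 (knot_len_le1 M0) sol)).
    by rewrite lee_fin; exact: sum_knot_len3.
  (* Were there no solution, [xget] would return its default, the zero function, whose norm is 0. *)
  have -> : torsion Omega = (fun=> 0).
    by apply: xgetPN => u su; apply: nex; exists u.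
  rewrite (_ : (fun x => _) = (fun=> 0%E)) ?integ0 ?lee_fin//.
  by apply/funext => x; rewrite normr0 powR0// gt_eqF.
have i0 : 0 <= fine (integ (fun x => (`|torsion Omega x| `^ p)%:E)).
  by apply/fine_ge0/integ_ge0 => x; rewrite lee_fin powR_ge0.
rewrite /Lpnorm; apply: (@le_trans _ _ (2 `^ p^-1)).
  by apply: ge0_ler_powR => //; rewrite ?nnegrE ?invr_ge0// ltW.
by apply: ler1_powR; rewrite ?ler1n// invf_le1.
Qed.

Theorem theorem2 (R : realType) (m : nat) (p : R) :
  (1 <= m)%N -> 1 <= p ->
  ereal_inf [set (Fp p Omega)%:E | Omega in
    [set Omega : set 'rV[R]_m | open Omega /\
       (0 < leb Omega)%E /\ (leb Omega < +oo)%E]] = 0%E.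
Proof.
case: m => // m _ p1; have p0 : 0 < p by exact: lt_le_trans p1.
apply/eqP; rewrite eq_le; apply/andP; split; last first.
  by apply: le_ereal_inf_tmp => _ [U _ <-]; rewrite lee_fin Fp_ge0.
have [l l0 lub] := @lambda1_ub R m.+1.
apply/lee_addgt0Pr => e e0; rewrite add0e.
(* Since F_p <= 2 l / (1 + M)^(1/p), it suffices that (1 + M)^(1/p) >= a, because e a = 2 l + e; the
   added 1 keeps [a] positive when l = 0. *)
pose a := 2 * l / e + 1.
have a0 : 0 < a by rewrite ltr_wpDl// divr_ge0 ?mulr_ge0// ltW.
pose M := (Num.trunc (a `^ p)).+1.
have M0 : (0 < M)%N by [].
pose Omega := @cyl R m (slabs (@knot R M) (M * M).+1).
have oU := @open_slabs R (@knot R M) (M * M).+1.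
have lO : leb Omega = (1 + M%:R)%:E.
  rewrite /Omega leb_cyl; last exact: open_measurable.
  by rewrite (slabs_measure (knot_lt M0)) knot_total.
apply: ge_ereal_inf; exists (Fp p Omega)%:E.
  exists Omega => //; split; first exact: open_cyl.
  by rewrite lO ltry lte_fin ltr_wpDr.
rewrite lee_fin /Fp lO /=.
have lam : fine (lambda1 Omega) <= l.
  apply: fine_le_of_le => //; first exact: lambda1_ge0.
  by apply: lub; exact: box_sub_knot.
have lam0 : 0 <= fine (lambda1 Omega) by exact/fine_ge0/lambda1_ge0.
have aM : a <= (1 + M%:R) `^ p^-1.
  have -> : a = (a `^ p) `^ p^-1.
    by rewrite -powRrM divff ?gt_eqF// powRr1// ltW.
  apply: ge0_ler_powR; rewrite ?nnegrE ?invr_ge0 ?powR_ge0 ?addr_ge0 ?ltW//.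
  by rewrite (lt_le_trans (truncnS_gt _))// lerDr.
rewrite ler_pdivrMr; last exact: lt_le_trans aM.
apply: (@le_trans _ _ (2 * l)).
  by apply: ler_pM => //; [exact: powR_ge0|exact: torsion_Lp_le2].
apply: (@le_trans _ _ (e * a)); last by rewrite ler_pM2l.
have -> : e * a = 2 * l + e by rewrite /a; field; rewrite gt_eqF.
by rewrite lerDl ltW.
Qed.
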